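(* Let $N\ge1$ and consider time steps $t_n=n\Delta t$, $0\le n\le N$, with $N\Delta t\le T$. Suppose that at the initial time $t_0=0$ the vehicle and the obstacles are disjoint, i.e. $\mathcal{V}(z(0))\cap\bigcup_{1\le i\le k}\mathcal{O}_i(0)=\emptyset$, that $0\le\Delta t<\overline{\Delta t}$ where $\overline{\Delta t}:=\underline{d}/\overline{v}$, and that $$g(z(t_n),t_n)<0,\quad\forall n=1,\dots,N.$$ Then there is no collision at all discrete time steps $t_n$, i.e. $$\mathcal{V}(z(t_n))\cap\Big(\bigcup_{1\le i\le k}\mathcal{O}_i(t_n)\Big)=\emptyset\qquad\forall n=1,\dots,N.$$
   Context: For $\psi\in\mathbb{R}$ let $R_\psi=\begin{pmatrix}\cos\psi&-\sin\psi\\ \sin\psi&\cos\psi\end{pmatrix}$, and for $j=1,\dots,4$ let $T_j=\begin{pmatrix}(-1)^{j-1}&0\\0&(-1)^{\lfloor (j-1)/2\rfloor}\end{pmatrix}$. Vehicle: fix half-lengths $\ell=(\ell_x,\ell_y)^T$ with $\ell_x,\ell_y>0$. For $z=(x,y,\psi,v)\in\mathbb{R}^4$, with $X=(x,y)^T$, the vehicle is the closed rectangle $\mathcal{V}(z)=X+R_\psi([-\ell_x,\ell_x]\times[-\ell_y,\ell_y])$, with corners $X_j(z)=X+R_\psi T_j\ell$, $1\le j\le4$. Let $T>0$. The vehicle trajectory $z=(x,y,\psi,v):[0,T]\to\mathbb{R}^4$ is an absolutely continuous solution of the point mass model $x'=v\cos\psi$, $y'=v\sin\psi$, $\psi'=w$,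 $v'=a$ (a.e. on $[0,T]$), with measurable controls $a(t)\in[a_{min},a_{max}]$, $|w(t)|\le w_{max}$. Obstacles: let $k\ge1$. For $1\le i\le k$, obstacle $i$ has half-lengths $\ell^i=(\ell^i_x,\ell^i_y)^T$ with positive entries, center $X^i(s)\in\mathbb{R}^2$ and orientation $\psi_i(s)\in\mathbb{R}$, where $X^i,\psi_i$ are Lipschitz continuous on $[0,T]$. It is the closed rectangle $\mathcal{O}_i(s)=X^i(s)+R_{\psi_i(s)}([-\ell^i_x,\ell^i_x]\times[-\ell^i_y,\ell^i_y])$, with corners $X^i_j(s)=X^i(s)+R_{\psi_i(s)}T_j\ell^i$, $1\le j\le4$. For a half-length vector $\lambda=(\lambda_x,\lambda_y)$ and $Y=(y_1,y_2)^T$ let $d_\lambda(Y):=\min(\lambda_x-|y_1|,\lambda_y-|y_2|)$, and let $d_{\mathcal{V}(z)}(Y):=d_\ell(R_{-\psi}(Y-X))$, $d_{\mathcal{O}_i(s)}(Y):=d_{\ell^i}(R_{-\psi_i(s)}(Y-X^i(s)))$. The obstacle function is $$g(z,s):=\max_{1\le i\le k}\max\Big(\max_{1\le j\le4}d_{\mathcal{V}(z)}(X^i_j(s)),\ \max_{1\le j\le4}d_{\mathcal{O}_i(s)}(X_j(z))\Big).$$ The minimal half-length is $\underline{d}:=\min\big(\ell_x,\ell_y,\min_{1\le i\le k}\min(\ell^i_x,\ell^i_y)\big)$. The number $\overline{v}$ is an upper bound for all relative velocities between vehicle corners and obstacle corners: writing $X_j(s)=X_j(z(s))$, $$\|\dot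 X_j(s)-\dot X^i_{j'}(s)\|\le\overline{v}\quad\text{for all }1\le j,j'\le4,\ 1\le i\le k\text{ and (almost) all }s\in[0,T],$$ with $\|\cdot\|$ the Euclidean norm and the convention $\underline{d}/\overline{v}=+\infty$ if $\overline{v}=0$. *)

(* Defs.v *)
From HB Require Import structures.
From mathcomp Require Import all_boot all_order all_algebra.
From mathcomp Require Import all_classical all_reals all_analysis.
From mathcomp Require Import measurable_realfun.

Set Implicit Arguments.
Unset Strict Implicit.
Unset Printing Implicit Defensive.

Import Order.TTheory GRing.Theory Num.Theory.
Import numFieldNormedType.Exports.

Local Open Scope classical_set_scope.
Local Open Scope ring_scope.

Definition col2 (R : realType) (a b : R) : 'cV[R]_2 :=
  \col_i (if i == 0 then a else b).

Definition mx2 (R : realType) (a b c d : R) : 'M[R]_2 :=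
  \matrix_(i, j) (if i == 0 then if j == 0 then a else b
                  else if j == 0 then c else d).

(* The library norm on matrices is the sup norm. *)
Definition euclidean_norm (R : realType) (u : 'cV[R]_2) : R :=
  Num.sqrt (u 0 0 ^+ 2 + u 1 0 ^+ 2).

Definition rotation (R : realType) (psi : R) : 'M[R]_2 :=
  mx2 (cos psi) (- sin psi) (sin psi) (cos psi).

(* Corners are indexed by 'I_4 = {0, 1, 2, 3} instead of {1, 2, 3, 4}: the
   index j below stands for the informal index j + 1. *)
Definition corner_sign (R : realType) (j : 'I_4) : 'M[R]_2 :=
  mx2 ((-1) ^+ j) 0 0 ((-1) ^+ j./2).

Definition rectangle (R : realType) (X : 'cV[R]_2) (psi : R) (l : 'cV[R]_2) :
    set 'cV[R]_2 :=
  [set X + rotation psi *m col2 a b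
     | a in `[- l 0 0, l 0 0] & b in `[- l 1 0, l 1 0]].

Definition corner (R : realType) (X : 'cV[R]_2) (psi : R) (l : 'cV[R]_2)
    (j : 'I_4) : 'cV[R]_2 :=
  X + rotation psi *m corner_sign R j *m l.

Definition box_dist (R : realType) (l Y : 'cV[R]_2) : R :=
  Num.min (l 0 0 - `|Y 0 0|) (l 1 0 - `|Y 1 0|).

Definition rectangle_dist (R : realType) (X : 'cV[R]_2) (psi : R)
    (l Y : 'cV[R]_2) : R :=
  box_dist l (rotation (- psi) *m (Y - X)).

Record state (R : realType) := State {
  pos_x : R;
  pos_y : R;
  heading : R;
  speed : R }.

Definition position (R : realType) (z : state R) : 'cV[R]_2 :=
  col2 (pos_x z) (pos_y z).

Definition vehicle (R : realType) (l : 'cV[R]_2) (z : state R) :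
    set 'cV[R]_2 :=
  rectangle (position z) (heading z) l.

Definition vehicle_corner (R : realType) (l : 'cV[R]_2) (z : state R)
    (j : 'I_4) : 'cV[R]_2 :=
  corner (position z) (heading z) l j.

Definition vehicle_dist (R : realType) (l : 'cV[R]_2) (z : state R)
    (Y : 'cV[R]_2) : R :=
  rectangle_dist (position z) (heading z) l Y.

Record obstacle (R : realType) := Obstacle {
  half_lengths : 'cV[R]_2;
  center : R -> 'cV[R]_2;
  orientation : R -> R }.

Definition obstacle_set (R : realType) (o : obstacle R) (s : R) :
    set 'cV[R]_2 :=
  rectangle (center o s) (orientation o s) (half_lengths o).

Definition obstacle_corner (R : realType) (o : obstacle R) (s : R)
    (j : 'I_4) : 'cV[R]_2 :=
  corner (center o s) (orientation o s) (half_lengths o) j.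

Definition obstacle_dist (R : realType) (o : obstacle R) (s : R)
    (Y : 'cV[R]_2) : R :=
  rectangle_dist (center o s) (orientation o s) (half_lengths o) Y.

(* Maximum of a nonempty finite family; the unit F ord0 of the iterated
   operation is itself a member of the family. *)
Definition ord_max_val (R : realType) (n : nat) (F : 'I_n.+1 -> R) : R :=
  \big[Num.max/F ord0]_(i < n.+1) F i.

(* A family of k.+1 obstacles: there is at least one. *)
Definition obstacle_function (R : realType) (k : nat) (l : 'cV[R]_2)
    (obs : 'I_k.+1 -> obstacle R) (z : state R) (s : R) : R :=
  ord_max_val (fun i : 'I_k.+1 =>
    Num.max
      (ord_max_val (fun j : 'I_4 =>
         vehicle_dist l z (obstacle_corner (obs i) s j)))
      (ord_max_val (fun j : 'I_4 =>
         obstacle_dist (obs i) s (vehicle_corner l z j)))).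

Definition min_half_length (R : realType) (k : nat) (l : 'cV[R]_2)
    (obs : 'I_k.+1 -> obstacle R) : R :=
  \big[Num.min/Num.min (l 0 0) (l 1 0)]_(i < k.+1)
     Num.min (half_lengths (obs i) 0 0) (half_lengths (obs i) 1 0).

Definition positive_lengths (R : realType) (l : 'cV[R]_2) : Prop :=
  0 < l 0 0 /\ 0 < l 1 0.

Definition absolutely_continuous_on (R : realType) (a b : R) (f : R -> R) :
    Prop :=
  forall e : R, 0 < e -> exists2 d : R, 0 < d &
    forall (n : nat) (u v : 'I_n -> R),
      (forall i, [/\ a <= u i, u i <= v i & v i <= b]) ->
      trivIset setT (fun i => `]u i, v i[%classic) ->
      \sum_(i < n) (v i - u i) < d ->
      \sum_(i < n) `|f (v i) - f (u i)| < e.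

(* Measurability with respect to the Lebesgue (completed Borel) sigma-algebra
   on the source and the Borel sigma-algebra on the target. *)
Definition lebesgue_measurable_fun (R : realType) (D : set R) (f : R -> R) :
    Prop :=
  @measurable_fun _ _
    (g_sigma_algebraType (completed_algebra_gen (@lebesgue_measure R)))
    (measurableTypeR R) D f.

Definition point_mass_trajectory (R : realType) (T amin amax wmax : R)
    (a w : R -> R) (z : R -> state R) : Prop :=
  [/\ [/\ absolutely_continuous_on 0 T (fun t => pos_x (z t)),
          absolutely_continuous_on 0 T (fun t => pos_y (z t)),
          absolutely_continuous_on 0 T (fun t => heading (z t)) &
          absolutely_continuous_on 0 T (fun t => speed (z t))],
      lebesgue_measurable_fun `[0, T] a /\ lebesgue_measurable_fun `[0, T] w,
      forall t, 0 <= t <= T -> amin <= a t <= amax /\ `|w t| <= wmax &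
      {ae @lebesgue_measure R, forall t : R, 0 <= t <= T ->
        [/\ is_derive (t : R^o) 1 (fun s => pos_x (z s) : R^o)
              (speed (z t) * cos (heading (z t))),
            is_derive (t : R^o) 1 (fun s => pos_y (z s) : R^o)
              (speed (z t) * sin (heading (z t))),
            is_derive (t : R^o) 1 (fun s => heading (z s) : R^o) (w t) &
            is_derive (t : R^o) 1 (fun s => speed (z s) : R^o) (a t)]}].

Definition lipschitz_obstacle (R : realType) (T : R) (o : obstacle R) : Prop :=
  [lipschitz (center o (t : R^o)) | t in `[0, T]] /\
  [lipschitz (orientation o (t : R^o) : R^o) | t in `[0, T]].

(* The corner trajectories are differentiable almost everywhere, so that the
   default value of the total derivative at other points is irrelevant. *)
Definition relative_speed_bound (R : realType) (T : R) (k : nat)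
    (l : 'cV[R]_2) (z : R -> state R) (obs : 'I_k.+1 -> obstacle R) (vbar : R) :
    Prop :=
  forall (j j' : 'I_4) (i : 'I_k.+1),
    {ae @lebesgue_measure R, forall s : R, 0 <= s <= T ->
      euclidean_norm
        (derive1 (fun t => vehicle_corner l (z t) j) s
         - derive1 (fun t => obstacle_corner (obs i) t j') s) <= vbar}.

(* The conventional value +oo for vbar = 0 is explicit, as d / 0 = 0 in R. *)
Definition max_time_step (R : realType) (d vbar : R) : \bar R :=
  if vbar == 0 then +oo%E else (d / vbar)%:E.

(* Main.v *)
(* Between two time steps every difference of a vehicle corner and an obstacle
   corner moves by at most vbar * dt < d, where d is the minimal half-length.
   If the rectangles are disjoint before the step, some unit vector n separates
   them, hence n.(P - Q) < d for all vehicle corners P and obstacle corners Q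
   after the step. If the rectangles met after the step with no corner of one
   inside the other, they would be crossing, and then n.(P - Q) >= d for some
   corners: a direction of penetration less than d may be taken normal to an
   edge, and in that direction a corner of one of the rectangles would lie in
   the other one.

   The bound on the displacement needs that an absolutely continuous function
   with nonpositive derivative almost everywhere is nonincreasing, and that the
   corners of the obstacles, which are only Lipschitz, are differentiable
   almost everywhere. *)
From HB Require Import structures.
Require Import Defs.
From mathcomp Require Import all_boot all_order all_algebra.
From mathcomp Require Import all_classical all_reals all_analysis.
From mathcomp Require Import measurable_realfun lra ring.

Set Implicit Arguments.
Unset Strict Implicit.
Unset Printing Implicit Defensive.

Import Order.TTheory GRing.Theory Num.Theory.
Import numFieldNormedType.Exports.

Local Open Scope classical_set_scope.
Local Open Scope ring_scope.

(** * Crossing rectangles *)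

Definition in_box (R : realFieldType) (a b x y : R) :=
  [/\ 0 <= x, x <= 2 * a, 0 <= y & y <= 2 * b].

(* V is the box [0, 2a] x [0, 2b], and O consists of the points
   B - sigma w - tau w' with B = (x0, beta), w = (c, s) and w' = (-s, c), so
   that B is the highest corner of O. If the corner 0 of V is not in O, the
   corner B - 2q w' of O lies above the bottom edge of V and beyond its right
   end; the edge of O from B to this corner is then too steep for beta < d. *)
Lemma crossing_left (R : realFieldType) (a b p q d c s x0 beta sigma tau : R) :
  0 < d -> d <= a -> d <= b -> d <= p -> d <= q ->
  0 <= c -> 0 <= s -> c ^+ 2 + s ^+ 2 = 1 ->
  beta < d -> x0 < 0 ->
  in_box p q sigma tau ->
  in_box a b (x0 - sigma * c + tau * s) (beta - sigma * s - tau * c) ->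
  ~ in_box p q (x0 * c + beta * s) (beta * c - x0 * s) ->
  ~ in_box a b (x0 + 2 * q * s) (beta - 2 * q * c) -> False.
Proof.
move=> d0 da db dp dq c0 s0 cs bd x00 [sg0 sgp ta0 taq].
move=> [px0 pxa py0 pyb] nA nB'.
have s1 : s <= 1 by nra.
have c1 : c <= 1 by nra.
have b0 : 0 <= beta by nra.
have sA0 : 0 <= x0 * c + beta * s by nra.
have sAp : x0 * c + beta * s <= 2 * p by nra.
have tA0 : 0 <= beta * c - x0 * s by nra.
(* The other three inequalities that would put the corner 0 of [V] in [O] hold, so the fourth fails.
   The same argument gives [Bxa] below. *)
have tAq : 2 * q < beta * c - x0 * s.
  by rewrite ltNge; apply/negP => h; apply: nA.
have By : 0 <= beta - 2 * q * c by nra.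
have Byb : beta - 2 * q * c <= 2 * b by nra.
have Bx0 : 0 <= x0 + 2 * q * s by nra.
have Bxa : 2 * a < x0 + 2 * q * s.
  by rewrite ltNge; apply/negP => h; apply: nB'.
have h1 : 2 * q < beta * c + s * (2 * q * s - 2 * a) by nra.
have h2 : 2 * q * c ^+ 2 + 2 * a * s < beta * c by nra.
have h3 : 2 * d * (c ^+ 2 + s) < d * c by nra.
(* As [0 <= s <= 1], the sum [c ^+ 2 + s] is at least [c ^+ 2 + s ^+ 2 = 1], so [h3] would force
   [2 < c]. *)
nra.
Qed.

(** This is the case of a penetration less than [d] normal to the bottom edge of [V]. The corner [B]
    is then beside [V]. On the left [crossing_left] applies; on the right, the reflection in the
    vertical midline of [V] reduces to it, exchanging [p] with [q], [c] with [s] and [sigma] with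
    [tau]. *)
Lemma crossing_axis (R : realFieldType) (a b p q d c s x0 beta sigma tau : R) :
  0 < d -> d <= a -> d <= b -> d <= p -> d <= q ->
  0 <= c -> 0 <= s -> c ^+ 2 + s ^+ 2 = 1 -> beta < d ->
  in_box p q sigma tau ->
  in_box a b (x0 - sigma * c + tau * s) (beta - sigma * s - tau * c) ->
  ~ in_box p q (x0 * c + beta * s) (beta * c - x0 * s) ->
  ~ in_box p q ((x0 - 2 * a) * c + beta * s) (beta * c - (x0 - 2 * a) * s) ->
  ~ in_box a b x0 beta ->
  ~ in_box a b (x0 - 2 * p * c) (beta - 2 * p * s) ->
  ~ in_box a b (x0 + 2 * q * s) (beta - 2 * q * c) -> False.
Proof.
move=> d0 da db dp dq c0 s0 cs bd Ost Vst nA nD nB nBp nBq.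
case: (ltP x0 0) => [x00|x00].
  exact: (@crossing_left _ a b p q d c s x0 beta sigma tau d0 da db dp dq
    c0 s0 cs bd x00 Ost Vst nA nBq).
move: (Ost) (Vst) => [sg0 sgp ta0 taq] [px0 pxa py0 pyb].
have b0 : 0 <= beta by nra.
(* The height of [B] lies in [[0, 2b]], so [B] can only be outside [V] by being to its right. *)
have x0a : 2 * a < x0.
  rewrite ltNge; apply/negP => h; apply: nB; split => //; lra.
apply: (@crossing_left _ a b q p d s c (2 * a - x0) beta tau sigma d0) => //.
- by rewrite addrC.
- lra.
- split => //; lra.
- by move=> [h1 h2 h3 h4]; apply: nD; split; lra.
- by move=> [h1 h2 h3 h4]; apply: nBp; split; lra.
Qed.

(* The coordinates are those of V, measured from its extremal corner A in the
   direction n, so that (x0, beta) is A - B with B the extremal corner of O in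
   the direction - n. As n lies between w = (c, s) and the second axis of V,
   n.(A - B) < d forces this bound for one of these two directions, and
   crossing_axis applies in the frame of V or in that of O. *)
Lemma crossing_sector (R : realFieldType)
    (a b p q d c s n1 n2 x0 beta x y : R) :
  0 < d -> d <= a -> d <= b -> d <= p -> d <= q ->
  0 <= c -> 0 <= s -> c ^+ 2 + s ^+ 2 = 1 ->
  n1 ^+ 2 + n2 ^+ 2 = 1 -> 0 <= n1 -> 0 <= n2 ->
  0 <= n1 * c + n2 * s -> 0 <= n2 * c - n1 * s ->
  x0 * n1 + beta * n2 < d ->
  in_box a b x y ->
  let inO x y := in_box p q ((x0 - x) * c + (beta - y) * s)
                            ((beta - y) * c - (x0 - x) * s) in
  inO x y ->
  ~ inO 0 0 -> ~ inO (2 * a) 0 -> ~ inO 0 (2 * b) ->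
  ~ in_box a b x0 beta ->
  ~ in_box a b (x0 - 2 * p * c) (beta - 2 * p * s) ->
  ~ in_box a b (x0 + 2 * q * s) (beta - 2 * q * c) -> False.
Proof.
move=> d0 da db dp dq c0 s0 cs nn n10 n20 nw nJw dn Vxy inO Oxy.
move=> nA nAa nAb nB nBp nBq.
have [bd|db'] := ltP beta d.
  move: (Oxy) (Vxy) => [s1 s2 t1 t2] [v1 v2 v3 v4].
  apply: (@crossing_axis _ a b p q d c s x0 beta _ _
    d0 _ _ _ _ _ _ _ _ Oxy) => //.
  - have -> : x0 - ((x0 - x) * c + (beta - y) * s) * c +
      ((beta - y) * c - (x0 - x) * s) * s = x0 - (x0 - x) * (c ^+ 2 + s ^+ 2).
      by ring.
    have -> : beta - ((x0 - x) * c + (beta - y) * s) * s -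
      ((beta - y) * c - (x0 - x) * s) * c =
      beta - (beta - y) * (c ^+ 2 + s ^+ 2).
      by ring.
    by rewrite cs; split; lra.
  - by move=> [h1 h2 h3 h4]; apply: nA; split; lra.
  - by move=> [h1 h2 h3 h4]; apply: nAa; split; lra.
(* In the frame of [O] at [B], with the two coordinates exchanged, the rectangles trade roles: [O]
   is the box with sides [2q], [2p], and the corner [A] of [V] takes the place of [B]. *)
have [wd|dw] := ltP (x0 * c + beta * s) d.
  move: (Oxy) (Vxy) => [s1 s2 t1 t2] [v1 v2 v3 v4].
  apply: (@crossing_axis _ q p b a d c s (beta * c - x0 * s) (x0 * c + beta * s)
    y x d0) => //.
  - by split; lra.
  - have -> : (beta * c - x0 * s) * c + (x0 * c + beta * s) * s =
      beta * (c ^+ 2 + s ^+ 2) by ring.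
    have -> : (x0 * c + beta * s) * c - (beta * c - x0 * s) * s =
      x0 * (c ^+ 2 + s ^+ 2) by ring.
    by rewrite cs; move=> [h1 h2 h3 h4]; apply: nB; split; lra.
  - have -> : (beta * c - x0 * s - 2 * q) * c + (x0 * c + beta * s) * s =
      beta * (c ^+ 2 + s ^+ 2) - 2 * q * c by ring.
    have -> : (x0 * c + beta * s) * c - (beta * c - x0 * s - 2 * q) * s =
      x0 * (c ^+ 2 + s ^+ 2) + 2 * q * s by ring.
    by rewrite cs; move=> [h1 h2 h3 h4]; apply: nBq; split; lra.
  - by move=> [h1 h2 h3 h4]; apply: nA; split; lra.
  - by move=> [h1 h2 h3 h4]; apply: nAb; split; lra.
  - by move=> [h1 h2 h3 h4]; apply: nAa; split; lra.
(* With [e] the second axis of [V], the vector [c n] equals [n1 w + j e]. The triangle inequality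
   gives [cn], and both [w] and [e] have inner product at least [d] with [A - B], hence so has
   [n]. *)
set j := n2 * c - n1 * s in nJw *.
have cn : c <= n1 + j.
  have s1 : s <= 1 by nra.
  have cE : c ^+ 2 = n1 ^+ 2 + j ^+ 2 + 2 * (n1 * j) * s.
    have -> : n1 ^+ 2 + j ^+ 2 + 2 * (n1 * j) * s =
      (n1 ^+ 2 + n2 ^+ 2) * c ^+ 2 + n1 ^+ 2 * (1 - (c ^+ 2 + s ^+ 2)).
      by rewrite /j; ring.
    by rewrite cs nn; ring.
  have nj0 : 0 <= n1 * j by rewrite mulr_ge0.
  have nj1 : 0 <= n1 * j * (1 - s) by rewrite mulr_ge0 // subr_ge0.
  have h : c ^+ 2 <= (n1 + j) ^+ 2 by rewrite cE; lra.
  by move: h; rewrite ler_sqr // nnegrE addr_ge0.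
(* If [c = 0], one cannot divide by [c], but then [w], [n] and the second axis of [V] coincide. *)
have [c00|cgt0] := leP c 0.
  have ceq0 : c = 0 by lra.
  have s1 : s = 1 by nra.
  have n1eq0 : n1 = 0.
    by move: nJw; rewrite /j ceq0 s1 mulr0 mulr1 sub0r oppr_ge0 => h; lra.
  have n2eq : n2 = 1.
    apply/eqP; rewrite -(@pexpr_eq1 _ n2 2)//; apply/eqP.
    by move: nn; rewrite n1eq0 expr0n add0r.
  by move: dn dw; rewrite ceq0 s1 n1eq0 n2eq !mulr0 !mulr1 !add0r => h1 h2; lra.
have key : c * (x0 * n1 + beta * n2) =
  n1 * (x0 * c + beta * s) + j * beta by rewrite /j; ring.
have : d * c <= c * (x0 * n1 + beta * n2).
  have h1 : n1 * d <= n1 * (x0 * c + beta * s) by rewrite ler_wpM2l.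
  have h2 : j * d <= j * beta by rewrite ler_wpM2l.
  rewrite key (le_trans _ (lerD h1 h2)) // -mulrDl mulrC.
  by rewrite ler_pM2r.
by rewrite mulrC ler_pM2l// leNgt dn.
Qed.

(** * Reduction of rectangles in general position to one frame *)

Section Rect.
Variable R : realFieldType.

(* (ux, uy) is the direction of the first axis of the rectangle; the second
   axis is its image (- uy, ux) under the quarter turn. *)
Record rect := Rect { cx : R; cy : R; ux : R; uy : R; hx : R; hy : R }.
Implicit Types (r V O : rect) (P n : R * R) (d : R) (e f : bool).

Definition unit_axis r := ux r ^+ 2 + uy r ^+ 2 = 1.

Definition inside r P :=
  `|ux r * (P.1 - cx r) + uy r * (P.2 - cy r)| <= hx r /\
  `|ux r * (P.2 - cy r) - uy r * (P.1 - cx r)| <= hy r.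

Definition vertex r e f : R * R :=
  (cx r + (-1) ^+ e * hx r * ux r - (-1) ^+ f * hy r * uy r,
   cy r + (-1) ^+ e * hx r * uy r + (-1) ^+ f * hy r * ux r).

(** The set of points stays the same; only its axes are relabelled, the second one becoming the
    first. *)
Definition quarter_turn r := Rect (cx r) (cy r) (- uy r) (ux r) (hy r) (hx r).

Lemma inside_quarter_turn r P : inside (quarter_turn r) P <-> inside r P.
Proof.
rewrite /inside /=.
have -> : - uy r * (P.1 - cx r) + ux r * (P.2 - cy r) =
  ux r * (P.2 - cy r) - uy r * (P.1 - cx r) by ring.
have -> : - uy r * (P.2 - cy r) - ux r * (P.1 - cx r) =
  - (ux r * (P.1 - cx r) + uy r * (P.2 - cy r)) by ring.
by rewrite normrN; split=> -[].
Qed.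

Lemma vertex_quarter_turn r e f :
  vertex (quarter_turn r) e f = vertex r (~~ f) e.
Proof. by rewrite /vertex /=; case: e f => [] []; congr pair => /=; ring. Qed.

(** A quarter turn sends the components [(p, q)] of [n] along the axes to [(q, - p)], so at most
    three turns bring [n] into the closed first quadrant. *)
Lemma wlog_quarter_turn n (Phi : rect -> Prop) :
  (forall r, Phi (quarter_turn r) -> Phi r) ->
  (forall r, unit_axis r -> 0 <= n.1 * ux r + n.2 * uy r ->
     0 <= n.2 * ux r - n.1 * uy r -> Phi r) ->
  forall r, unit_axis r -> Phi r.
Proof.
move=> turn base r.
have U r' : unit_axis r' -> unit_axis (quarter_turn r').
  by rewrite /unit_axis /= sqrrN addrC.
have [h1|h1] := lerP 0 (n.1 * ux r + n.2 * uy r);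
  have [h2|h2] := lerP 0 (n.2 * ux r - n.1 * uy r) => Ur.
- exact: base.
- do 3![apply/turn]; apply: base => /=; first by do 3![apply/U].
    by lra.
  by lra.
- apply/turn; apply: base => /=; first exact: U.
    by lra.
  by lra.
- do 2![apply/turn]; apply: base => /=; first by do 2![apply/U].
    by lra.
  by lra.
Qed.

(** The last clause limits how far [V] reaches along [n] beyond the lower end of [O]; it holds after
    a short time step when [n] separated the rectangles before it. *)
Definition crossing d V O n :=
  [/\ exists2 P, inside V P & inside O P,
      forall e f, ~ inside O (vertex V e f),
      forall e f, ~ inside V (vertex O e f) &
      forall e f e' f',
        n.1 * ((vertex V e f).1 - (vertex O e' f').1) +
        n.2 * ((vertex V e f).2 - (vertex O e' f').2) < d].

Lemma crossing_quarter_turnl d V O n :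
  crossing d V O n -> crossing d (quarter_turn V) O n.
Proof.
case=> -[P VP OP] h1 h2 h3; split.
- by exists P => //; apply/inside_quarter_turn.
- by move=> e f; rewrite vertex_quarter_turn.
- by move=> e f /inside_quarter_turn; apply: h2.
- by move=> e f e' f'; rewrite vertex_quarter_turn.
Qed.

Lemma crossing_swap d V O n :
  crossing d V O n -> crossing d O V (- n.1, - n.2).
Proof.
case=> -[P VP OP] h1 h2 h3; split => //; first by exists P.
by move=> e f e' f'; have := h3 e' f' e f => /=; lra.
Qed.

Lemma crossing_quarter_turnr d V O n :
  crossing d V O n -> crossing d V (quarter_turn O) n.
Proof.
move=> /crossing_swap/crossing_quarter_turnl/crossing_swap /=.
by rewrite !opprK; case: n.
Qed.

Let scaleU r (t : R) : unit_axis r -> t = t * (ux r ^+ 2 + uy r ^+ 2).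
Proof. by move=> ->; rewrite mulr1. Qed.

(** [A] is the vertex of [V] extremal in every direction of its first quadrant, and the coordinates
    run from [A] into [V]. The variant [dot_insideN] starts from the opposite vertex; it serves for
    [O]. *)
Let dot_inside (V : rect) (x y : R) A Z : unit_axis V ->
  A = vertex V false false ->
  x = ux V * (A.1 - Z.1) + uy V * (A.2 - Z.2) ->
  y = ux V * (A.2 - Z.2) - uy V * (A.1 - Z.1) ->
  in_box (hx V) (hy V) x y <-> inside V Z.
Proof.
move=> UV -> {A}.
set X := ux V * (Z.1 - cx V) + uy V * (Z.2 - cy V).
set Y := ux V * (Z.2 - cy V) - uy V * (Z.1 - cx V).
move=> xE yE.
have {}xE : x = hx V - X.
  rewrite xE /X /vertex /= !expr0 !mul1r [in RHS](scaleU (hx V) UV); ring.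
have {}yE : y = hy V - Y.
  rewrite yE /Y /vertex /= !expr0 !mul1r [in RHS](scaleU (hy V) UV); ring.
rewrite /inside -/X -/Y !ler_norml xE yE; split.
  by case=> *; split; apply/andP; split; lra.
by case=> /andP[h1 h2] /andP[h3 h4]; split; lra.
Qed.

Let dot_insideN (V : rect) (x y : R) A Z : unit_axis V ->
  A = vertex V true true ->
  x = ux V * (Z.1 - A.1) + uy V * (Z.2 - A.2) ->
  y = ux V * (Z.2 - A.2) - uy V * (Z.1 - A.1) ->
  in_box (hx V) (hy V) x y <-> inside V Z.
Proof.
move=> UV -> {A}.
set X := ux V * (Z.1 - cx V) + uy V * (Z.2 - cy V).
set Y := ux V * (Z.2 - cy V) - uy V * (Z.1 - cx V).
move=> xE yE.
have {}xE : x = hx V + X.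
  rewrite xE /X /vertex /= !expr1 [in RHS](scaleU (hx V) UV); ring.
have {}yE : y = hy V + Y.
  rewrite yE /Y /vertex /= !expr1 [in RHS](scaleU (hy V) UV); ring.
rewrite /inside -/X -/Y !ler_norml xE yE; split.
  by case=> *; split; apply/andP; split; lra.
by case=> /andP[h1 h2] /andP[h3 h4]; split; lra.
Qed.

Let no_crossing_sector d V O n : 0 < d ->
  d <= hx V -> d <= hy V -> d <= hx O -> d <= hy O ->
  unit_axis V -> unit_axis O -> n.1 ^+ 2 + n.2 ^+ 2 = 1 ->
  0 <= n.1 * ux V + n.2 * uy V -> 0 <= n.2 * ux V - n.1 * uy V ->
  0 <= n.1 * ux O + n.2 * uy O -> 0 <= n.2 * ux O - n.1 * uy O ->
  0 <= ux V * uy O - uy V * ux O ->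
  ~ crossing d V O n.
Proof.
move=> d0 dVx dVy dOx dOy UV UO nn nV nJV nO nJO s0 [[P VP OP] hV hO hn].
set A := vertex V false false; set B := vertex O true true.
pose c := ux V * ux O + uy V * uy O.
pose s := ux V * uy O - uy V * ux O.
(* In these coordinates [V] is the box of [crossing_sector], and [B] is its point [(x0, beta)]. *)
pose X Z : R := ux V * (A.1 - Z.1) + uy V * (A.2 - Z.2).
pose Y Z : R := ux V * (A.2 - Z.2) - uy V * (A.1 - Z.1).
have inV Z : in_box (hx V) (hy V) (X Z) (Y Z) <-> inside V Z.
  exact: (dot_inside UV erefl erefl erefl).
have inO Z : in_box (hx O) (hy O) ((X B - X Z) * c + (Y B - Y Z) * s)
    ((Y B - Y Z) * c - (X B - X Z) * s) <-> inside O Z.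
  apply: (dot_insideN UO erefl); rewrite /X /Y /c /s -/B.
    transitivity ((ux V ^+ 2 + uy V ^+ 2) *
      (ux O * (Z.1 - B.1) + uy O * (Z.2 - B.2))); first by ring.
    by rewrite UV mul1r.
  transitivity ((ux V ^+ 2 + uy V ^+ 2) *
    (ux O * (Z.2 - B.2) - uy O * (Z.1 - B.1))); first by ring.
  by rewrite UV mul1r.
(* The inner product of the two first axes is expanded in an orthonormal basis containing [n]; both
   axes have nonnegative components there. *)
have c0 : 0 <= c.
  have -> : c = (n.1 * ux V + n.2 * uy V) * (n.1 * ux O + n.2 * uy O) +
      (n.2 * ux V - n.1 * uy V) * (n.2 * ux O - n.1 * uy O).
    transitivity ((n.1 ^+ 2 + n.2 ^+ 2) * c); first by rewrite nn mul1r.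
    by rewrite /c; ring.
  by rewrite addr_ge0 // mulr_ge0.
have cs : c ^+ 2 + s ^+ 2 = 1.
  transitivity ((ux V ^+ 2 + uy V ^+ 2) * (ux O ^+ 2 + uy O ^+ 2)).
    by rewrite /c /s; ring.
  by rewrite UV UO mulr1.
have XA : X A = 0 by rewrite /X; ring.
have YA : Y A = 0 by rewrite /Y; ring.
have Xa : X (vertex V true false) = 2 * hx V.
  by rewrite [RHS](scaleU _ UV) /X /vertex /= !expr0 !expr1; ring.
have Ya : Y (vertex V true false) = 0.
  by rewrite /Y /vertex /= !expr0 !expr1; ring.
have Xb : X (vertex V false true) = 0.
  by rewrite /X /vertex /= !expr0 !expr1; ring.
have Yb : Y (vertex V false true) = 2 * hy V.
  by rewrite [RHS](scaleU _ UV) /Y /vertex /= !expr0 !expr1; ring.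
have Xp : X (vertex O false true) = X B - 2 * hx O * c.
  by rewrite /X /B /c /vertex /= !expr0 !expr1; ring.
have Yp : Y (vertex O false true) = Y B - 2 * hx O * s.
  by rewrite /Y /B /s /vertex /= !expr0 !expr1; ring.
have Xq : X (vertex O true false) = X B + 2 * hy O * s.
  by rewrite /X /B /s /vertex /= !expr0 !expr1; ring.
have Yq : Y (vertex O true false) = Y B - 2 * hy O * c.
  by rewrite /Y /B /c /vertex /= !expr0 !expr1; ring.
apply: (@crossing_sector R (hx V) (hy V) (hx O) (hy O) d c s
  (n.1 * ux V + n.2 * uy V) (n.2 * ux V - n.1 * uy V) (X B) (Y B) (X P) (Y P)
  d0 dVx dVy dOx dOy c0 s0 cs _ nV nJV).
- transitivity ((n.1 ^+ 2 + n.2 ^+ 2) * (ux V ^+ 2 + uy V ^+ 2)); first by ring.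
  by rewrite nn UV mulr1.
- suff -> : (n.1 * ux V + n.2 * uy V) * c + (n.2 * ux V - n.1 * uy V) * s =
    (ux V ^+ 2 + uy V ^+ 2) * (n.1 * ux O + n.2 * uy O) by rewrite UV mul1r.
  by rewrite /c /s; ring.
- suff -> : (n.2 * ux V - n.1 * uy V) * c - (n.1 * ux V + n.2 * uy V) * s =
    (ux V ^+ 2 + uy V ^+ 2) * (n.2 * ux O - n.1 * uy O) by rewrite UV mul1r.
  by rewrite /c /s; ring.
- suff -> : X B * (n.1 * ux V + n.2 * uy V) + Y B * (n.2 * ux V - n.1 * uy V) =
    (ux V ^+ 2 + uy V ^+ 2) * (n.1 * (A.1 - B.1) + n.2 * (A.2 - B.2)).
    by rewrite UV mul1r; exact: hn.
  by rewrite /X /Y; ring.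
- exact: (inV P).2.
- exact: (inO P).2.
- by move=> h; apply: (hV false false); apply: (inO _).1; rewrite XA YA.
- by move=> h; apply: (hV true false); apply: (inO _).1; rewrite Xa Ya.
- by move=> h; apply: (hV false true); apply: (inO _).1; rewrite Xb Yb.
- by move=> h; apply: (hO true true); apply: (inV _).1.
- by move=> h; apply: (hO false true); apply: (inV _).1; rewrite Xp Yp.
- by move=> h; apply: (hO true false); apply: (inV _).1; rewrite Xq Yq.
Qed.

Lemma no_crossing d V O n : 0 < d ->
  d <= hx V -> d <= hy V -> d <= hx O -> d <= hy O ->
  unit_axis V -> unit_axis O -> n.1 ^+ 2 + n.2 ^+ 2 = 1 -> ~ crossing d V O n.
Proof.
move=> d0 Vx Vy Ox Oy UV UO nn; move: V UV Vx Vy.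
apply: (@wlog_quarter_turn n) => [V IH Vx Vy cr|V UV nV nJV Vx Vy].
  by apply: IH => //; exact: crossing_quarter_turnl.
move: O UO Ox Oy.
apply: (@wlog_quarter_turn n) => [r IH rx ry cr|].
  by apply: IH => //; exact: crossing_quarter_turnr.
move=> O UO nO nJO Ox Oy.
have [s0|s0] := lerP 0 (ux V * uy O - uy V * ux O).
  exact: no_crossing_sector.
(* Exchanging the rectangles changes the sign of the cross product of their axes, but also of [n];
   two quarter turns of each rectangle bring [- n] back into both first quadrants. *)
move=> /crossing_swap.
move=> /crossing_quarter_turnl/crossing_quarter_turnl.
move=> /crossing_quarter_turnr/crossing_quarter_turnr.
apply: no_crossing_sector => //=; rewrite /unit_axis /= ?sqrrN //; lra.
Qed.
End Rect.

(** * Almost everywhere derivatives *)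

(** Let [c] be the supremum of the points of [[a, b]] in [S]. The step at [c] leads from a point of
    [S] just left of [c], or [c] itself, to a point beyond [c], unless [c = b]. *)
Lemma interval_induction (R : realType) (a b : R) (S : set R) : a <= b ->
  S a ->
  (forall c, a <= c <= b -> exists2 r, 0 < r &
    forall x y, a <= x -> S x -> c - r < x -> x <= c -> c <= y ->
      y < c + r -> y <= b -> S y) ->
  S b.
Proof.
move=> ab Sa step.
pose E := S `&` `[a, b].
have Ea : E a by split => //=; rewrite in_itv /= lexx ab.
have Esup : has_sup E.
  by split; [exists a|exists b => x [_]; rewrite /= in_itv /= => /andP[]].
pose c := sup E.
have ac : a <= c by apply: sup_upper_bound.
have cb : c <= b.
  by apply: ge_sup; [exists a|move=> x [_]; rewrite /= in_itv /= => /andP[]].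
have [|r r0 rS] := step c; first by rewrite ac cb.
have [x [Sx]] := sup_adherent r0 Esup.
rewrite -/c /= in_itv /= => /andP[ax xb] cx.
have xc : x <= c.
  by apply: sup_upper_bound => //; split => //=; rewrite in_itv/= ax.
pose y := Num.min b (c + r / 2).
have cy : c <= y by rewrite le_min cb lerDl divr_ge0// ltW.
have yb : y <= b by rewrite ge_min lexx.
have Sy : S y.
  apply: (rS x) => //; rewrite gt_min; apply/orP; right.
  by rewrite ltrD2l ltr_pdivrMr// ltr_pMr// ltr1n.
have yc : y <= c.
  apply: sup_upper_bound => //; split => //=.
  by rewrite in_itv /= yb (le_trans ac).
suff -> : b = y by [].
move: yc; rewrite /y ge_min => /orP[bc|].
  apply/eqP; rewrite eq_le yb le_min lexx (le_trans bc)//.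
  by rewrite lerDl divr_ge0// ltW.
by rewrite gerDl leNgt divr_gt0.
Qed.

(** As [c] lies between [x] and [y], the increment splits at [c] into two parts, each controlled by
    the derivative at this single point. *)
Lemma derivable_slope_le (R : realType) (f : R -> R) (c e : R) : 0 < e ->
  derivable (f : R^o -> R^o) c 1 -> 'D_1 (f : R^o -> R^o) c <= 0 ->
  exists2 r, 0 < r & forall x y, c - r < x -> x <= c -> c <= y -> y < c + r ->
    f y - f x <= e * (y - x).
Proof.
move=> e0 df D0.
have /cvgrPdist_le := df.
rewrite -/(derive _ _ _) => /(_ _ e0) [r /= r0 hr].
have H h : `|h| < r -> h != 0 -> h^-1 * (f (h + c) - f c) <= e.
  move=> hr0 h0; have := hr h; rewrite /ball_ /= sub0r normrN => /(_ hr0 h0).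
  rewrite ler_norml => /andP[+ _]; rewrite [h *: 1]mulr1 => h1.
  have h2 : - e <= 'D_1 (f : R^o -> R^o) c - h^-1 * (f (h + c) - f c) := h1.
  by move: h2 D0; lra.
exists r => // x y cx xc cy yc.
have hy : f y - f c <= e * (y - c).
  have [->|yc0] := eqVneq y c; first by rewrite !subrr mulr0.
  have yc1 : 0 < y - c by rewrite subr_gt0 lt_neqAle eq_sym yc0.
  have := H (y - c); rewrite gtr0_norm// subrK => /(_ _ _).
  rewrite ler_pdivrMl// mulrC; apply; last by rewrite gt_eqF.
  by rewrite ltrBlDl.
have hx : f c - f x <= e * (c - x).
  have [->|xc0] := eqVneq x c; first by rewrite !subrr mulr0.
  have xc1 : 0 < c - x by rewrite subr_gt0 lt_neqAle xc0.
  have := H (x - c); rewrite -normrN opprB gtr0_norm// subrK => /(_ _ _).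
  have -> : (x - c)^-1 * (f x - f c) = (c - x)^-1 * (f c - f x).
    by rewrite -(opprB c x) -(opprB (f c)) invrN mulrNN.
  rewrite ler_pdivrMl// mulrC; apply; last by rewrite subr_eq0.
  by rewrite ltrBlDr -ltrBlDl.
by have := lerD hy hx; lra.
Qed.

Lemma sum_length_lt (R : realType) (U : set R) (d : R) (n : nat)
    (u v : nat -> R) :
  open U -> (@lebesgue_measure R U < d%:E)%E ->
  (forall i, (i < n)%N -> u i <= v i) ->
  (forall i, (i < n)%N -> `]u i, v i[%classic `<=` U) ->
  trivIset `I_n (fun i => `]u i, v i[%classic) ->
  \sum_(i < n) (v i - u i) < d.
Proof.
move=> oU Ud uv sU tI.
rewrite -lte_fin; apply: le_lt_trans Ud.
rewrite -sumEFin.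
have -> : (\sum_(i < n) (v i - u i)%:E =
    \sum_(i < n) lebesgue_measure (`]u i, v i[%classic : set R))%E.
  apply: eq_bigr => i _; rewrite lebesgue_measure_itv /= lte_fin.
  case: ltP => [//|vu].
  have -> : v i = u i by apply/eqP; rewrite eq_le vu uv.
  by rewrite subrr.
have mI i : measurable (`]u i, v i[%classic : set R) by exact: measurable_itv.
rewrite -(@measure_semi_additive_ord _ _ _ (@lebesgue_measure R) n
  (fun i => `]u i, v i[%classic)) //.
- apply: le_measure; rewrite ?inE.
  + by apply: bigsetU_measurable => i _.
  + exact: open_measurable.
  + rewrite -(bigcup_mkord n (fun i => `]u i, v i[%classic)).
    by move=> x [i /= /sU]; apply.
- apply/trivIsetP => i j _ _ ij.
  by have /trivIsetP := tI; apply => //=.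
- by apply: bigsetU_measurable => i _.
Qed.

(* S x bounds f x - f a by a small slope, up to the variation of f on finitely
   many disjoint intervals that lie in an open set U of small measure
   containing the exceptional points. *)
Lemma absolutely_continuous_derive_le0 (R : realType) (a b : R) (f : R -> R) :
  a <= b -> absolutely_continuous_on a b f ->
  {ae @lebesgue_measure R, forall x, a < x < b ->
    derivable (f : R^o -> R^o) x 1 /\ 'D_1 (f : R^o -> R^o) x <= 0} ->
  f b <= f a.
Proof.
move=> ab acf [A [mA A0 PA]].
apply/ler_addgt0Pr => e e0.
(* Half of [e] pays for the slope over [[a, b]], the other half for the exceptional intervals.
   Adding 1 keeps the denominator positive when [a = b]. *)
pose e1 := e / 2 / (b - a + 1).
have ba1 : 0 < b - a + 1 by lra.
have e10 : 0 < e1 by rewrite !divr_gt0.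
have [d d0 acd] := acf (e / 2) (divr_gt0 e0 (ltr0n _ 2)).
(* The endpoints count as exceptional because the derivative is controlled only inside []a, b[]. *)
pose A' := A `|` [set a] `|` [set b].
have mA' : measurable A'.
  by do 2![apply: measurableU => //]; exact: measurable_set1.
have A'0 : lebesgue_measure A' = 0%E.
  rewrite /A' !measureU0//; try exact: measurable_set1;
    try exact: lebesgue_measure_set1.
  by apply: measurableU => //; exact: measurable_set1.
have [|U [oU AU UA]] := @lebesgue_regularity_outer R A' d mA' _ d0.
  by rewrite [ltLHS]A'0 ltry.
have Ud : (lebesgue_measure U < d%:E)%E.
  apply: le_lt_trans UA.
  have {1}-> : U = (U `\` A') `|` A' by rewrite setUC setDUK.
  have mD : measurable (U `\` A').
    by apply: measurableD => //; exact: open_measurable.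
  apply: (le_trans (@measureU2 _ _ _ (@lebesgue_measure R) _ _ mD mA')).
  by rewrite [X in (_ + X)%E]A'0 adde0.
pose S (x : R) := exists n (u v : nat -> R),
  [/\ forall i, (i < n)%N -> [/\ a <= u i, u i <= v i & v i <= x],
      forall i, (i < n)%N -> `]u i, v i[%classic `<=` U,
      trivIset `I_n (fun i => `]u i, v i[%classic) &
      f x - f a <= e1 * (x - a) + \sum_(i < n) (f (v i) - f (u i))].
have [n [u [v [h1 h2 h3 h4]]]] : S b.
  apply: (@interval_induction _ a b) => //.
    exists 0%N, (fun=> 0), (fun=> 0).
    by split => //; rewrite big_ord0 !subrr mulr0 addr0.
  move=> c /andP[ac cb].
  (* At an exceptional point the increment is charged to a new interval []x, y[] inside [U]; at any
     other point it is charged to the slope [e1] and the family is kept. *)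
  have [A'c|A'c] := pselect (A' c).
    have /nbhs_ballP [r /= r0 rU] : nbhs c U.
      by apply: open_nbhs_nbhs; split => //; exact: AU.
    exists r => // x y ax [n [u [v [h1 h2 h3 h4]]]] cx xc cy yc yb.
    have xy : x <= y := le_trans xc cy.
    exists n.+1, (fun i => if (i < n)%N then u i else x),
      (fun i => if (i < n)%N then v i else y); split.
    - move=> i _; case: ifP => [/h1[? ? ?]|_]; split => //; exact: le_trans xy.
    - move=> i _; case: ifP => [/h2//|_].
      move=> t /=; rewrite in_itv /= => /andP[xt ty]; apply: rU.
      by rewrite /ball /= ltr_distlC; apply/andP; split; lra.
    - have D i : (i < n)%N -> `]u i, v i[%classic `&` `]x, y[%classic = set0.
        move=> /h1[_ _ vx]; apply/seteqP; split => // t /= [].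
        rewrite !in_itv /= => /andP[_ tv] /andP[xt _].
        by have := lt_le_trans tv vx; rewrite ltNge ltW.
      apply/trivIsetP => i j /= i1 j1 ij.
      case: ifPn => i2; case: ifPn => j2.
      + by have /trivIsetP := h3; apply.
      + exact: D.
      + by rewrite setIC; exact: D.
      + move: i1 j1; rewrite !ltnS => i1 j1; move: ij.
        have -> : i = n by apply/eqP; rewrite eqn_leq i1 leqNgt.
        have -> : j = n by apply/eqP; rewrite eqn_leq j1 leqNgt.
        by rewrite eqxx.
    - rewrite big_ord_recr /= ltnn.
      have -> : \sum_(i < n) (f (if (i < n)%N then v i else y) -
          f (if (i < n)%N then u i else x)) = \sum_(i < n) (f (v i) - f (u i)).
        by apply: eq_bigr => i _; rewrite ltn_ord.
      have : 0 <= e1 * (y - x) by rewrite mulr_ge0 ?subr_ge0 // ltW.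
      by lra.
  have Pc : a < c < b ->
      derivable (f : R^o -> R^o) c 1 /\ 'D_1 (f : R^o -> R^o) c <= 0.
    by apply: contrapT => h; apply: A'c; left; left; apply: PA.
  have [|df D0] := Pc.
    rewrite !lt_neqAle ac cb !andbT; apply/andP; split; apply/negP => /eqP h.
      by apply: A'c; left; right.
    by apply: A'c; right.
  have [r r0 hr] := derivable_slope_le e10 df D0.
  exists r => // x y ax [n [u [v [h1 h2 h3 h4]]]] cx xc cy yc yb.
  exists n, u, v; split => //.
    by move=> i /h1[? ? ?]; split => //; exact: le_trans (le_trans xc cy).
  by have := hr x y cx xc cy yc; lra.
have : \sum_(i < n) `|f (v i) - f (u i)| < e / 2.
  apply: (acd n (fun i => u i) (fun i => v i)).
  - by move=> i; exact: h1.
  - apply/trivIsetP => i j _ _ ij.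
    by have /trivIsetP := h3; apply => //=.
  - by apply: sum_length_lt Ud _ h2 h3 => // i /h1[].
have : \sum_(i < n) (f (v i) - f (u i)) <= \sum_(i < n) `|f (v i) - f (u i)|.
  by apply: ler_sum => i _; exact: ler_norm.
have : e1 * (b - a) <= e / 2.
  rewrite /e1 mulrAC ler_pdivrMr// ler_wpM2l//; first by rewrite divr_ge0// ltW.
  by lra.
by lra.
Qed.

(** * Differentiability of Lipschitz functions *)

Lemma lebesgue_stieltjes_measure_itv_oc (R : realType) (g : cumulative R R)
  (a b : R) : a <= b ->
  lebesgue_stieltjes_measure g (`]a, b]%classic) = (g b - g a)%:E.
Proof.
move=> ab; rewrite /lebesgue_stieltjes_measure /measure_extension /=.
rewrite measurable_mu_extE; last exact: is_ocitv.
by rewrite /= wlength_itv_bnd.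
Qed.

(** Both measures are infima over countable covers by half-open intervals, and on such an interval
    the increment of [g] is at most [K] times the length. A cover of small total length thus has
    small total increment. *)
Lemma lebesgue_stieltjes_measure_dominated (R : realType) (g : cumulative R R)
  (K : R) : (forall x y, x <= y -> g y - g x <= K * (y - x)) ->
  lebesgue_stieltjes_measure g `<< @lebesgue_measure R.
Proof.
move=> gK; apply/null_content_dominatesP => A mA A0.
have K0 : 0 <= K.
  have := gK 0 1 ler01; rewrite subr0 mulr1; apply: le_trans.
  by rewrite subr_ge0; apply: (cumulative_is_nondecreasing g); exact: ler01.
apply/eqP; rewrite eq_le measure_ge0 andbT.
apply/lee_addgt0Pr => e e0; rewrite add0e.
pose e' := e / (K + 1).
have e'0 : 0 < e' by rewrite divr_gt0// ltr_wpDl.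
have : (lebesgue_measure A < e'%:E)%E by rewrite A0 lte_fin.
move=> /ereal_inf_lt[_ [B BA <-] BK].
apply: (@le_trans _ _ (\sum_(k <oo) wlength g (B k))%E).
  by apply: ereal_inf_lbound; exists B.
apply: (@le_trans _ _ (\sum_(k <oo) (K%:E * wlength idfun (B k)))%E).
  apply: lee_nneseries => [k *|k _]; first by apply: wlength_ge0.
  have /= [ab _ <-] := cover_measurable BA k.
  have [h|h] := leP ab.1 ab.2; last first.
    rewrite set_itv_ge; first by rewrite !wlength0 mule0.
    by rewrite bnd_simp -leNgt ltW.
  by rewrite !wlength_itv_bnd// -EFinM lee_fin gK.
rewrite nneseriesZl//.
apply: (@le_trans _ _ (K%:E * e'%:E)%E).
  by apply: lee_wpmul2l; [rewrite lee_fin|exact: ltW].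
rewrite -EFinM lee_fin /e' mulrA ler_pdivrMr ?ltr_wpDl//.
by rewrite mulrC ler_wpM2l ?ltW// ltrDl.
Qed.

(* The nondecreasing function f x + L * x defines a Stieltjes measure dominated
   by the Lebesgue measure; integrating its Radon-Nikodym derivative gives f
   back up to an affine function, so that FTC1 applies. *)
Lemma lipschitz_ae_derivable (R : realType) (f : R -> R) (L a b : R) :
  (forall x y, `|f x - f y| <= L * `|x - y|) ->
  {ae @lebesgue_measure R, forall x, a < x < b ->
    derivable (f : R^o -> R^o) x 1}.
Proof.
move=> fL.
have [ab|ba] := ltP a b; last first.
  apply: aeW => x /andP[ax xb]; exfalso.
  by have := lt_trans ax xb; rewrite ltNge ba.
have L0 : 0 <= L.
  have := fL 0 1; rewrite sub0r normrN normr1 mulr1.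
  exact: le_trans.
pose g0 x := f x + L * x.
have g0nd : nondecreasing g0.
  move=> x y xy; rewrite /g0 /=.
  have := fL x y; rewrite [`|x - y|]ler0_norm ?subr_le0// ler_norml => /andP[_].
  by lra.
have g0K x y : x <= y -> g0 y - g0 x <= (L + L) * (y - x).
  move=> xy; rewrite /g0.
  have := fL y x; rewrite [`|y - x|]ger0_norm ?subr_ge0// ler_norml => /andP[_].
  by lra.
have g0c : continuous g0.
  move=> x; apply: cvgD; last by apply: cvgM; [exact: cvg_cst|exact: cvg_id].
  apply/cvgrPdist_le => e e0; near=> y.
  apply: (le_trans (fL x y)).
  have : `|x - y| <= e / (L + 1).
    near: y; apply: cvgr_dist_le; last by rewrite divr_gt0// ltr_wpDl.
    exact: cvg_id.
  move=> h; apply: (@le_trans _ _ (L * (e / (L + 1)))).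
    by rewrite ler_wpM2l.
  rewrite mulrA ler_pdivrMr ?ltr_wpDl// mulrC ler_wpM2l ?ltW// ltrDl//.
pose g : cumulative R R :=
  HB.pack g0 (isCumulative.Build R _ R g0 g0nd (right_continuousW g0c)).
pose mug : {measure set (measurableTypeR R) -> \bar R} :=
  lebesgue_stieltjes_measure g.
(* The restriction to []a, b]] makes the measure finite, as Radon-Nikodym requires here. *)
pose D : set (measurableTypeR R) := `]a, b]%classic.
have mD : measurable D by exact: measurable_itv.
have mugD : (mug D < +oo)%E.
  by rewrite /mug /D /= lebesgue_stieltjes_measure_itv_oc ?ltW// ltry.
pose nu : {finite_measure set (measurableTypeR R) -> \bar R} := mfrestr mD mugD.
have nudom : nu `<< @lebesgue_measure R.
  apply/null_content_dominatesP => A mA A0.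
  have /null_content_dominatesP :=
    @lebesgue_stieltjes_measure_dominated R g _ g0K.
  apply => //; first exact: measurableI.
  apply/eqP; rewrite -measure_le0 -A0 le_measure ?inE//; exact: measurableI.
have [h [h0 hfin hint hnu]] := radon_nikodym_sigma_finite nudom.
have hE : EFin \o (fine \o h) = h by apply/funext => x /=; rewrite fineK.
have hintE : (@lebesgue_measure R).-integrable setT (EFin \o (fine \o h)).
  by rewrite hE.
have := @FTC1 R (fine \o h) (BRight a).
have h1 : forall y, lebesgue_measure.-integrable
    [set` Interval (BRight a) (BRight y)] (EFin \o (fine \o h)).
  by move=> y; apply: integrableS hintE.
move=> /(_ h1 (open_integrable_locally openT hintE)) /=.
apply: filterS; first exact: (ae_filter_ringOfSetsType (@lebesgue_measure R)).
move=> x xP /andP[ax xb].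
have [|dF _] := xP; first by rewrite lte_fin.
pose F y := (\int[lebesgue_measure]_(t in `]a, y]) (fine \o h) t)%R.
(* [F y] is the mass of []a, y]], that is [g0 y - g0 a]; the formula solves this for [f y]. *)
have FE y : a <= y <= b -> f y = F y + (f a + L * a) - L * y.
  move=> /andP[ay yb].
  rewrite /F /Rintegral.
  have -> : (\int[lebesgue_measure]_(t in `]a, y]) ((fine \o h) t)%:E =
      nu `]a, y]%classic)%E.
    by rewrite hnu; [rewrite -[in RHS]hE|exact: measurable_itv].
  have -> : nu `]a, y]%classic = mug (`]a, y]%classic `&` D) by [].
  rewrite setIidl; last first.
    move=> t; rewrite /D /= !in_itv /= => /andP[lat lty].

    by rewrite lat (le_trans lty).
  by rewrite /mug /= lebesgue_stieltjes_measure_itv_oc //= /g0; ring.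
have dc : derivable (fun _ : R^o => f a + L * a : R^o) x 1.
  exact: derivable_cst.
have dl : derivable (fun y : R^o => L * y : R^o) x 1.
  exact: (@derivableZ R R^o R^o id L x 1 (@derivable_id R R^o x 1)).
have dF' : derivable (F : R^o -> R^o) x 1 by exact: dF.
have dG : derivable (fun y => F y + (f a + L * a) - L * y : R^o) x 1.
  exact: (@derivableB R R^o R^o _ _ x 1
    (@derivableD R R^o R^o _ _ x 1 dF' dc) dl).
move: dG; apply: near_eq_derivable => //.
near=> y; apply/esym/FE; apply/andP; split; apply: ltW; near: y.
  exact: lt_nbhsr.
exact: lt_nbhsl.
Unshelve. all: by end_near. Qed.

(** * Motion of the corners *)

Lemma absolutely_continuous_sub (R : realType) (a b s t : R) (f : R -> R) :
  a <= s -> t <= b -> absolutely_continuous_on a b f ->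
  absolutely_continuous_on s t f.
Proof.
move=> sa bt ac e e0; have [d d0 H] := ac e e0; exists d => // n u v uv.
apply: H => i; have [h1 h2 h3] := uv i.
by split => //; [exact: le_trans h1|exact: le_trans bt].
Qed.

Lemma lipschitz_absolutely_continuous (R : realType) (a b K : R) (f : R -> R) :
  (forall x y, a <= x <= b -> a <= y <= b -> `|f x - f y| <= K * `|x - y|) ->
  absolutely_continuous_on a b f.
Proof.
move=> fK e e0.
have K1 : 0 < `|K| + 1 by rewrite ltr_wpDl.
exists (e / (`|K| + 1)); first by rewrite divr_gt0.
move=> n u v uv _ sd.
apply: (@le_lt_trans _ _ (\sum_(i < n) (`|K| + 1) * (v i - u i))).
  apply: ler_sum => i _; have [h1 h2 h3] := uv i.
  apply: (le_trans (fK _ _ _ _)); try (apply/andP; split).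
  - exact: le_trans h2.
  - exact: h3.
  - exact: h1.
  - exact: le_trans h3.
  rewrite ger0_norm ?subr_ge0// ler_wpM2r ?subr_ge0//.
  by rewrite (le_trans (ler_norm _))// lerDl.
by rewrite -mulr_sumr mulrC -ltr_pdivlMr.
Qed.

(** This form covers linear combinations and, with [f = g], Lipschitz functions of an absolutely
    continuous function, such as [cos (psi t)]. *)
Lemma absolutely_continuous_dominated (R : realType) (a b K : R)
    (f g h : R -> R) :
  (forall x y, `|h x - h y| <= K * (`|f x - f y| + `|g x - g y|)) ->
  absolutely_continuous_on a b f -> absolutely_continuous_on a b g ->
  absolutely_continuous_on a b h.
Proof.
move=> hK acf acg e e0.
have K1 : 0 < `|K| + 1 by rewrite ltr_wpDl.
have e'0 : 0 < e / (`|K| + 1) / 2 by rewrite !divr_gt0.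
have [d1 d10 H1] := acf _ e'0; have [d2 d20 H2] := acg _ e'0.
exists (Num.min d1 d2); first by rewrite lt_min d10.
move=> n u v uv tI; rewrite lt_min.
move=> /andP[/(H1 _ _ _ uv tI) h1 /(H2 _ _ _ uv tI) h2].
apply: (@le_lt_trans _ _ ((`|K| + 1) *
  (\sum_(i < n) `|f (v i) - f (u i)| + \sum_(i < n) `|g (v i) - g (u i)|))).
  rewrite -big_split mulr_sumr; apply: ler_sum => i _ /=.
  apply: (le_trans (hK _ _)); apply: ler_wpM2r; first by rewrite addr_ge0.
  by rewrite (le_trans (ler_norm _))// lerDl.
by rewrite mulrC -ltr_pdivlMr// [ltRHS]splitr ltrD.
Qed.

Lemma absolutely_continuousD (R : realType) (a b c : R) (f g : R -> R) :
  absolutely_continuous_on a b f -> absolutely_continuous_on a b g ->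
  absolutely_continuous_on a b (fun x => f x + c * g x).
Proof.
apply: (@absolutely_continuous_dominated _ _ _ (1 + `|c|)) => x y.
have -> : f x + c * g x - (f y + c * g y) =
  (f x - f y) + c * (g x - g y) by ring.
rewrite (le_trans (ler_normD _ _))// normrM.
have := normr_ge0 c; have := normr_ge0 (f x - f y).
have := normr_ge0 (g x - g y).
by nra.
Qed.

Lemma absolutely_continuous_derive_le (R : realType) (a b M : R) (f : R -> R) :
  a <= b -> absolutely_continuous_on a b f ->
  {ae @lebesgue_measure R, forall x, a < x < b ->
    derivable (f : R^o -> R^o) x 1 /\ 'D_1 (f : R^o -> R^o) x <= M} ->
  f b - f a <= M * (b - a).
Proof.
move=> ab acf df.
have acid : absolutely_continuous_on a b id.
  apply: (@lipschitz_absolutely_continuous _ _ _ 1) => x y _ _.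
  by rewrite mul1r.
have : f b + (- M) * b <= f a + (- M) * a.
  apply: (@absolutely_continuous_derive_le0 R a b
    (fun x => f x + (- M) * x) ab).
    exact: absolutely_continuousD.
  have FA := ae_filter_ringOfSetsType (@lebesgue_measure R).
  move: df; apply: filterS.
  move=> x dfx /dfx [df dM].
  have dl : is_derive (x : R^o) 1 (fun y : R^o => (- M) * y : R^o) (- M).
    have := @is_deriveZ R R^o R^o id (- M) x 1 1 (@is_derive_id _ _ _ _).
    by rewrite [_ *: 1]mulr1.
  have df' : is_derive (x : R^o) 1 (f : R^o -> R^o) ('D_1 (f : R^o -> R^o) x).
    exact/derivableP.
  have dsum := @is_deriveD R R^o R^o _ _ x 1 _ _ df' dl.
  split; first exact: (@ex_derive _ _ _ _ _ _ _ dsum).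
  by rewrite (@derive_val _ _ _ _ _ _ _ dsum) subr_le0.
by lra.
Qed.

Lemma is_derive_le1_lipschitz (R : realType) (f df : R -> R) :
  (forall t : R, is_derive t 1 f (df t)) -> (forall t, `|df t| <= 1) ->
  forall x y, `|f x - f y| <= `|x - y|.
Proof.
move=> fdf df1 x y.
wlog xy : x y / x < y => [H|].
  have [/H //|/H|->] := ltgtP x y; last by rewrite !subrr.
  by rewrite distrC [leRHS]distrC.
have [|c _ fE] := @MVT _ f df x y xy (fun t _ => fdf t).
  apply: continuous_subspaceT => t; apply: differentiable_continuous.
  by apply/derivable1_diffP; exact: ex_derive.
by rewrite distrC [leRHS]distrC fE normrM ler_piMl.
Qed.

Lemma cos_lipschitz (R : realType) (x y : R) : `|cos x - cos y| <= `|x - y|.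
Proof.
apply: is_derive_le1_lipschitz => t; rewrite normrN ler_norml.
by rewrite sin_geN1 sin_le1.
Qed.

Lemma sin_lipschitz (R : realType) (x y : R) : `|sin x - sin y| <= `|x - y|.
Proof.
by apply: is_derive_le1_lipschitz => t; rewrite ler_norml cos_geN1 cos_le1.
Qed.

(** The regularity shared by the vehicle and the obstacles. Derivatives are taken only inside []0,
    T[], since at an endpoint they would depend on values outside [[0, T]]. *)
Definition regular_pose (R : realType) (T : R) (X : R -> 'cV[R]_2)
    (psi : R -> R) :=
  [/\ absolutely_continuous_on 0 T (fun t => X t 0 0),
      absolutely_continuous_on 0 T (fun t => X t 1 0),
      absolutely_continuous_on 0 T psi &
      {ae @lebesgue_measure R, forall t, 0 < t < T ->
        [/\ derivable (fun t : R^o => X t 0 0 : R^o) t 1,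
            derivable (fun t : R^o => X t 1 0 : R^o) t 1 &
            derivable (psi : R^o -> R^o) t 1]}].

Lemma corner0E (R : realType) (X : 'cV[R]_2) psi l j :
  corner X psi l j 0 0 =
  X 0 0 + (-1) ^+ j * l 0 0 * cos psi - (-1) ^+ j./2 * l 1 0 * sin psi.
Proof.
rewrite /corner -mulmxA !mxE !big_ord_recl big_ord0 !mxE /=.
rewrite !big_ord_recl !big_ord0 !mxE /=.
have -> : lift ord0 ord0 = 1 :> 'I_2 by apply/val_inj.
by ring.
Qed.

Lemma corner1E (R : realType) (X : 'cV[R]_2) psi l j :
  corner X psi l j 1 0 =
  X 1 0 + (-1) ^+ j * l 0 0 * sin psi + (-1) ^+ j./2 * l 1 0 * cos psi.
Proof.
rewrite /corner -mulmxA !mxE !big_ord_recl big_ord0 !mxE /=.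
rewrite !big_ord_recl !big_ord0 !mxE /=.
have -> : lift ord0 ord0 = 1 :> 'I_2 by apply/val_inj.
by ring.
Qed.

Section CornerRegularity.
Variables (R : realType) (T : R) (X : R -> 'cV[R]_2) (psi : R -> R).
Variables (l : 'cV[R]_2) (j : 'I_4).
Hypothesis acX : regular_pose T X psi.

Lemma ac_corner i :
  absolutely_continuous_on 0 T (fun t => corner (X t) (psi t) l j i 0).
Proof.
have [ac0 ac1 acp _] := acX.
have acc : absolutely_continuous_on 0 T (fun t => cos (psi t)).
  apply: (@absolutely_continuous_dominated _ _ _ 1 psi psi) (acp) (acp) => x y.
  by rewrite mul1r (le_trans (cos_lipschitz _ _))// lerDl.
have acs : absolutely_continuous_on 0 T (fun t => sin (psi t)).
  apply: (@absolutely_continuous_dominated _ _ _ 1 psi psi) (acp) (acp) => x y.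
  by rewrite mul1r (le_trans (sin_lipschitz _ _))// lerDl.
have i01 : i = 0 \/ i = 1.
  by case: i => [[|[|//]] ?]; [left|right]; apply/val_inj.
case: i01 => ->.
  have -> : (fun t => corner (X t) (psi t) l j 0 0) = (fun t => X t 0 0 +
      (-1) ^+ j * l 0 0 * cos (psi t) + - ((-1) ^+ j./2 * l 1 0) * sin (psi t)).
    by apply/funext => t; rewrite corner0E -mulNr.
  exact: (absolutely_continuousD _ (absolutely_continuousD _ ac0 acc) acs).
have -> : (fun t => corner (X t) (psi t) l j 1 0) = (fun t => X t 1 0 +
    (-1) ^+ j * l 0 0 * sin (psi t) + (-1) ^+ j./2 * l 1 0 * cos (psi t)).
  by apply/funext => t; rewrite corner1E.
exact: (absolutely_continuousD _ (absolutely_continuousD _ ac1 acs) acc).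
Qed.

Lemma derivable_corner t :
  derivable (fun t : R^o => X t 0 0 : R^o) t 1 ->
  derivable (fun t : R^o => X t 1 0 : R^o) t 1 ->
  derivable (psi : R^o -> R^o) t 1 ->
  derivable (fun t : R^o => corner (X t) (psi t) l j) t 1.
Proof.
move=> d0 d1 dp; apply/derivable_mxP => i k; rewrite (ord1 k).
have dc : derivable (fun t : R^o => cos (psi t) : R^o) t 1.
  exact: (@ex_derive _ _ _ _ _ _ _
    (is_derive1_comp (is_derive_cos _) (derivableP dp))).
have ds : derivable (fun t : R^o => sin (psi t) : R^o) t 1.
  exact: (@ex_derive _ _ _ _ _ _ _
    (is_derive1_comp (is_derive_sin _) (derivableP dp))).
have i01 : i = 0 \/ i = 1.
  by case: i => [[|[|//]] ?]; [left|right]; apply/val_inj.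
have dD c f g : derivable (f : R^o -> R^o) t 1 ->
    derivable (g : R^o -> R^o) t 1 ->
    derivable (fun x => f x + c * g x : R^o) t 1.
  move=> df dg.
  exact: (@derivableD R R^o R^o _ _ t 1 df (@derivableZ R R^o R^o _ c t 1 dg)).
case: i01 => ->.
  under eq_fun do rewrite corner0E -mulNr.
  exact: (dD _ _ _ (dD _ _ _ d0 dc) ds).
under eq_fun do rewrite corner1E.
exact: (dD _ _ _ (dD _ _ _ d1 ds) dc).
Qed.
End CornerRegularity.

Definition dot (R : realType) (u v : 'cV[R]_2) : R :=
  u 0 0 * v 0 0 + u 1 0 * v 1 0.

Lemma dot_le_euclidean_norm (R : realType) (n u : 'cV[R]_2) :
  dot n n = 1 -> dot n u <= euclidean_norm u.
Proof.
rewrite /dot -!expr2 => n1; apply: (le_trans (ler_norm _)).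
rewrite -sqrtr_sqr /euclidean_norm ler_sqrt ?addr_ge0 ?sqr_ge0//.
set a := n 0 0 in n1 *; set b := n 1 0 in n1 *; set x := u 0 0; set y := u 1 0.
(* Lagrange's identity, plus a term that vanishes because [n] is a unit vector. *)
have -> : x ^+ 2 + y ^+ 2 =
  (a * x + b * y) ^+ 2 + (a * y - b * x) ^+ 2 +
  (1 - (a ^+ 2 + b ^+ 2)) * (x ^+ 2 + y ^+ 2) by ring.
by rewrite n1 subrr mul0r addr0 lerDl sqr_ge0.
Qed.

Lemma is_derive_mx_entry (R : realType) (m n : nat) (M : R -> 'M[R]_(m, n))
    x i j :
  derivable (M : R^o -> 'M[R]_(m, n)) x 1 ->
  is_derive (x : R^o) 1 (fun t : R^o => M t i j : R^o)
    ('D_1 (M : R^o -> 'M[R]_(m, n)) x i j).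
Proof.
move=> dM; rewrite derive_mx // mxE; apply/derivableP.
by move/derivable_mxP : dM; apply.
Qed.

(** The derivative of the left-hand quantity in time is the inner product of [n] with the relative
    velocity, at most [v] by Cauchy-Schwarz. *)
Lemma corner_displacement (R : realType) (T v s t : R)
    (X Y : R -> 'cV[R]_2) (psi phi : R -> R) (l m : 'cV[R]_2) (j k : 'I_4)
    (n : 'cV[R]_2) :
  regular_pose T X psi -> regular_pose T Y phi ->
  {ae @lebesgue_measure R, forall s : R, 0 <= s <= T ->
     euclidean_norm (derive1 (fun t => corner (X t) (psi t) l j) s -
                     derive1 (fun t => corner (Y t) (phi t) m k) s) <= v} ->
  dot n n = 1 ->
  0 <= s -> s <= t -> t <= T ->
  dot n (corner (X t) (psi t) l j - corner (Y t) (phi t) m k) -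
  dot n (corner (X s) (psi s) l j - corner (Y s) (phi s) m k) <= v * (t - s).
Proof.
move=> acX acY dv n1 s0 st tT.
pose F t := corner (X t) (psi t) l j; pose G t := corner (Y t) (phi t) m k.
(* Writing the inner product as an iterated [a + c * b] lets one rule for absolute continuity and
   one for derivatives, each applied four times, handle it. *)
pose h (a b : R -> R) (c : R) t := a t + c * b t.
pose f := h (h (h (h (fun=> 0) (fun t => F t 0 0) (n 0 0))
                  (fun t => F t 1 0) (n 1 0))
               (fun t => G t 0 0) (- n 0 0))
            (fun t => G t 1 0) (- n 1 0).
have fE x : dot n (corner (X x) (psi x) l j - corner (Y x) (phi x) m k) = f x.
  by rewrite /dot /f /h !mxE -/(F x) -/(G x); ring.
rewrite !fE.
have ac0 : absolutely_continuous_on 0 T (fun=> 0 : R).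
  apply: (@lipschitz_absolutely_continuous _ _ _ 0) => x y _ _.
  by rewrite subrr normr0 mul0r.
apply: (absolutely_continuous_derive_le st).
  apply: (absolutely_continuous_sub s0 tT).
  have acD p q c : absolutely_continuous_on 0 T p ->
      absolutely_continuous_on 0 T q -> absolutely_continuous_on 0 T (h p q c).
    exact: absolutely_continuousD.
  exact: (acD _ _ _ (acD _ _ _ (acD _ _ _ (acD _ _ _ ac0
    (ac_corner l j acX 0)) (ac_corner l j acX 1)) (ac_corner m k acY 0))
    (ac_corner m k acY 1)).
have [_ _ _ aeX] := acX; have [_ _ _ aeY] := acY.
have FA := ae_filter_ringOfSetsType (@lebesgue_measure R).
apply: filterS (filterI dv (filterI aeX aeY)).
move=> x [dvx [aeXx aeYx]] /andP[sx xt].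
have x0T : 0 < x < T by rewrite (le_lt_trans s0 sx) (lt_le_trans xt tT).
have dF : derivable (F : R^o -> 'cV[R]_2) x 1.
  by have [? ? ?] := aeXx x0T; exact: derivable_corner.
have dG : derivable (G : R^o -> 'cV[R]_2) x 1.
  by have [? ? ?] := aeYx x0T; exact: derivable_corner.
have dFi i := is_derive_mx_entry i 0 dF.
have dGi i := is_derive_mx_entry i 0 dG.
have dD (p q : R -> R) c dp dq : is_derive (x : R^o) 1 (p : R^o -> R^o) dp ->
    is_derive (x : R^o) 1 (q : R^o -> R^o) dq ->
    is_derive (x : R^o) 1 (h p q c : R^o -> R^o) (dp + c * dq).
  move=> hp hq.
  exact: (@is_deriveD R R^o R^o _ _ x 1 _ _ hp
    (@is_deriveZ R R^o R^o _ c x 1 _ hq)).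
have dotE (A B : 'cV[R]_2) : 0 + n 0 0 * A 0 0 + n 1 0 * A 1 0 +
    - n 0 0 * B 0 0 + - n 1 0 * B 1 0 = dot n (A - B).
  by rewrite /dot !mxE; ring.
have d0 : is_derive (x : R^o) 1 (fun=> 0 : R^o) (0 : R^o).
  exact: is_derive_cst.
have df := dD _ _ (- n 1 0) _ _ (dD _ _ (- n 0 0) _ _ (dD _ _ (n 1 0) _ _
  (dD _ _ (n 0 0) _ _ d0 (dFi 0)) (dFi 1)) (dGi 0)) (dGi 1).
split; first exact: (@ex_derive _ _ _ _ _ _ _ df).
rewrite (@derive_val _ _ _ _ _ _ _ df).
apply: le_trans (dvx _); last by apply/andP; split; apply: ltW; case/andP: x0T.
rewrite !derive1E; apply: le_trans (dot_le_euclidean_norm _ n1).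
by rewrite dotE.
Qed.

Lemma lipschitz_itvP (R : realType) (T : R) (V : normedModType R) (f : R -> V) :
  [lipschitz (f (t : R^o)) | t in `[0, T]] ->
  exists K, forall x y, 0 <= x <= T -> 0 <= y <= T ->
    `|f x - f y| <= K * `|x - y|.
Proof.
rewrite /lipschitz_on => /filter_ex [K fK]; exists K => x y xT yT.
by have := fK (x, y); apply; split; rewrite /= in_itv.
Qed.

Lemma lipschitz_itv_ae_derivable (R : realType) (T K : R) (f : R -> R) :
  (forall x y, 0 <= x <= T -> 0 <= y <= T -> `|f x - f y| <= K * `|x - y|) ->
  {ae @lebesgue_measure R, forall x, 0 < x < T ->
    derivable (f : R^o -> R^o) x 1}.
Proof.
move=> fK.
have FA := ae_filter_ringOfSetsType (@lebesgue_measure R).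
have [T0|T0] := ltP T 0.
  apply: aeW => x /andP[x0 xT]; exfalso.
  by have := lt_trans x0 (lt_trans xT T0); rewrite ltxx.
(* Clamping the argument to [[0, T]] makes [f] globally Lipschitz and changes nothing near interior
   points; [K] may be negative, whence the constant [|K|]. *)
pose c x := if x < 0 then 0 else if T < x then T else x.
have c0T x : 0 <= c x <= T.
  rewrite /c; case: ltP => [_|x0]; rewrite ?lexx //.
  by case: ltP; rewrite ?lexx ?T0 // x0.
have cE x : 0 <= x <= T -> c x = x.
  by move=> /andP[x0 xT]; rewrite /c !ltNge x0 xT.
have cL x y : `|c x - c y| <= `|x - y|.
  wlog xy : x y / x <= y => [H|].
    by have [/H //|/ltW/H] := leP x y; rewrite distrC [leRHS]distrC.
  rewrite distrC [leRHS]distrC [leRHS]ger0_norm ?subr_ge0// ler_norml /c.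
  by apply/andP; split; do ![case: ltP => ?]; lra.
have := @lipschitz_ae_derivable R (f \o c) `|K| 0 T.
have fcL x y : `|(f \o c) x - (f \o c) y| <= `|K| * `|x - y|.
  apply: (le_trans (fK _ _ (c0T x) (c0T y))).
  apply: (@le_trans _ _ (`|K| * `|c x - c y|)).
    by rewrite ler_wpM2r// ler_norm.
  by rewrite ler_wpM2l.
move=> /(_ fcL); apply: filterS => x dfx /[dup] x0T /dfx.
apply: near_eq_derivable.
have [x0 xT] := andP x0T.
near=> y; rewrite /= cE//; apply/andP; split; apply: ltW; near: y.
  exact: lt_nbhsr.
exact: lt_nbhsl.
Unshelve. all: by end_near. Qed.

Lemma lipschitz_regular_pose (R : realType) (T : R) (X : R -> 'cV[R]_2)
    (psi : R -> R) :
  [lipschitz (X (t : R^o)) | t in `[0, T]] ->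
  [lipschitz (psi (t : R^o) : R^o) | t in `[0, T]] -> regular_pose T X psi.
Proof.
move=> /(lipschitz_itvP (f := X))[K XK] /(lipschitz_itvP (V := R^o))[M psiM].
have XiK i x y : 0 <= x <= T -> 0 <= y <= T ->
    `|X x i 0 - X y i 0| <= K * `|x - y|.
  move=> xT yT; apply: le_trans (XK x y xT yT).
  rewrite [leRHS]/Num.Def.normr /= mx_normrE.
  by apply: le_trans (le_bigmax _ _ (i, 0)); rewrite /= !mxE.
have FA := ae_filter_ringOfSetsType (@lebesgue_measure R).
split.
- exact: lipschitz_absolutely_continuous (XiK 0).
- exact: lipschitz_absolutely_continuous (XiK 1).
- exact: lipschitz_absolutely_continuous psiM.
apply: filterS (filterI (lipschitz_itv_ae_derivable (XiK 0))
  (filterI (lipschitz_itv_ae_derivable (XiK 1))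
    (lipschitz_itv_ae_derivable psiM))).
by move=> x [h1 [h2 h3]] xT; split; [exact: h1|exact: h2|exact: h3].
Qed.

Lemma trajectory_regular_pose (R : realType) (T amin amax wmax : R)
    (a w : R -> R) (z : R -> state R) :
  point_mass_trajectory T amin amax wmax a w z ->
  regular_pose T (fun t => position (z t)) (fun t => heading (z t)).
Proof.
case=> -[acx acy acp _] _ _ dz.
have p0 : (fun t => position (z t) 0 0) = (fun t => pos_x (z t)).
  by apply/funext => t; rewrite mxE.
have p1 : (fun t => position (z t) 1 0) = (fun t => pos_y (z t)).
  by apply/funext => t; rewrite mxE.
have FA := ae_filter_ringOfSetsType (@lebesgue_measure R).
split; [by rewrite p0 | by rewrite p1 | exact: acp |].
apply: filterS dz => t dz /andP[t0 tT].
have [|[H0 _] [H1 _] [H2 _] _] := dz; first by rewrite !ltW.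
split; last exact: H2.
  by move: H0; apply: near_eq_derivable; near=> y; rewrite mxE.
by move: H1; apply: near_eq_derivable; near=> y; rewrite mxE.
Unshelve. all: by end_near. Qed.

(** * Separation of rectangles *)

Lemma rectangleP (R : realType) (X : 'cV[R]_2) (psi : R) (l P : 'cV[R]_2) :
  rectangle X psi l P <->
  exists a b, [/\ `|a| <= l 0 0, `|b| <= l 1 0,
    P 0 0 = X 0 0 + (cos psi * a - sin psi * b) &
    P 1 0 = X 1 0 + (sin psi * a + cos psi * b)].
Proof.
have E a b : [/\ (X + rotation psi *m col2 a b) 0 0 =
      X 0 0 + (cos psi * a - sin psi * b) &
    (X + rotation psi *m col2 a b) 1 0 = X 1 0 + (sin psi * a + cos psi * b)].
  by split; rewrite !mxE !big_ord_recl big_ord0 !mxE /= addr0 ?mulNr.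
split.
  move=> [a la [b lb <-]]; exists a, b; have [-> ->] := E a b.
  by split => //; rewrite ler_norml; [move: la|move: lb]; rewrite /= in_itv.
move=> [a [b [la lb P0 P1]]].
exists a; first by rewrite /= in_itv /= -ler_norml.
exists b; first by rewrite /= in_itv /= -ler_norml.
have [E0 E1] := E a b.
apply/matrixP => i k; rewrite (ord1 k).
have [->|->] : i = 0 \/ i = 1.
  by case: i => [[|[|//]] ?]; [left|right]; apply/val_inj.
  by rewrite E0 P0.
by rewrite E1 P1.
Qed.

(* n is opposite to the shortest difference of points of the rectangles. *)
Lemma rectangles_separated (R : realType) (X Y : 'cV[R]_2) (psi phi : R)
    (l m : 'cV[R]_2) :
  0 <= l 0 0 -> 0 <= l 1 0 -> 0 <= m 0 0 -> 0 <= m 1 0 ->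
  rectangle X psi l `&` rectangle Y phi m = set0 ->
  exists n, dot n n = 1 /\ forall P Q, rectangle X psi l P ->
    rectangle Y phi m Q -> dot n (P - Q) < 0.
Proof.
move=> l0 l1 m0 m1 disj.
(* A pair of points is given by its four local coordinates, which range over a compact box; [f] is
   the squared length of the difference. *)
pose px (v : (R * R) * (R * R)) := X 0 0 + (cos psi * v.1.1 - sin psi * v.1.2)
  - (Y 0 0 + (cos phi * v.2.1 - sin phi * v.2.2)).
pose py (v : (R * R) * (R * R)) := X 1 0 + (sin psi * v.1.1 + cos psi * v.1.2)
  - (Y 1 0 + (sin phi * v.2.1 + cos phi * v.2.2)).
pose f v := px v ^+ 2 + py v ^+ 2.
pose I (r : R) : set R := `[- r, r]%classic.
pose A := (I (l 0 0) `*` I (l 1 0)) `*` (I (m 0 0) `*` I (m 1 0)).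
have AP a b c d : A ((a, b), (c, d)) <->
    [/\ `|a| <= l 0 0, `|b| <= l 1 0, `|c| <= m 0 0 & `|d| <= m 1 0].
  rewrite /A /I /= !in_itv /= !ler_norml.
  by split=> [[[? ?] [? ?]]|[? ? ? ?]].
have A0 : A !=set0.
  by exists ((0, 0), (0, 0)); apply/AP; rewrite !normr0.
have cA : compact A.
  by apply: compact_setX; apply: compact_setX; exact: segment_compact.
have c11 : continuous (fun v : (R * R) * (R * R) => v.1.1).
  move=> v; apply: (continuous_comp (f := fst)); first exact: cvg_fst.
  exact: cvg_fst.
have c12 : continuous (fun v : (R * R) * (R * R) => v.1.2).
  move=> v; apply: (continuous_comp (f := fst)); first exact: cvg_fst.
  exact: cvg_snd.
have c21 : continuous (fun v : (R * R) * (R * R) => v.2.1).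
  move=> v; apply: (continuous_comp (f := snd)); first exact: cvg_snd.
  exact: cvg_fst.
have c22 : continuous (fun v : (R * R) * (R * R) => v.2.2).
  move=> v; apply: (continuous_comp (f := snd)); first exact: cvg_snd.
  exact: cvg_snd.
have cpx : continuous px.
  move=> v; apply: cvgB; apply: cvgD; try exact: cvg_cst.
    by apply: cvgB; apply: cvgM; try exact: cvg_cst; [exact: c11|exact: c12].
  by apply: cvgB; apply: cvgM; try exact: cvg_cst; [exact: c21|exact: c22].
have cpy : continuous py.
  move=> v; apply: cvgB; apply: cvgD; try exact: cvg_cst.
    by apply: cvgD; apply: cvgM; try exact: cvg_cst; [exact: c11|exact: c12].
  by apply: cvgD; apply: cvgM; try exact: cvg_cst; [exact: c21|exact: c22].
have cf : continuous f.
  by move=> v; apply: cvgD; apply: cvgM; (exact: cpx || exact: cpy).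
have [[[a b] [c d]]] := compact_EVT_min A0 cA (continuous_subspaceT cf).
rewrite inE => Av fmin; set v := ((a, b), (c, d)) in Av fmin.
have [la lb mc md] := (AP _ _ _ _).1 Av.
set x := px v; set y := py v.
have fv : 0 < f v.
  rewrite lt_neqAle addr_ge0 ?sqr_ge0// andbT eq_sym; apply/negP => fv0.
  move: fv0; rewrite /f paddr_eq0 ?sqr_ge0// !sqrf_eq0.
  move=> /andP[/eqP x0 /eqP y0].
  suff : set0 (X + rotation psi *m col2 a b) by [].
  rewrite -disj; split; apply/rectangleP.
    exists a, b.
    by split => //; rewrite !mxE !big_ord_recl big_ord0 !mxE /=; ring.
  exists c, d; split => //; rewrite !mxE !big_ord_recl big_ord0 !mxE /=.
    by move: x0; rewrite /px /=; lra.
  by move: y0; rewrite /py /=; lra.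
have conv r p q t : `|p| <= r -> `|q| <= r -> 0 <= t <= 1 ->
    `|p + t * (q - p)| <= r :> R.
  rewrite !ler_norml => /andP[p1 p2] /andP[q1 q2] /andP[t0 t1].
  by apply/andP; split; nra.
(* Variational inequality at the minimizer: [u] is the point at fraction [t] from [v] to [w]. If the
   inequality failed by [e], then [f u = f v - 2te + t^2 D], and the choice of [t] gives [t <= 1]
   and [t D <= e], so [f u < f v]. *)
have key w : A w -> f v <= x * px w + y * py w.
  case: w => [[a' b'] [c' d']] Aw; have [la' lb' mc' md'] := (AP _ _ _ _).1 Aw.
  set w := ((a', b'), (c', d')).
  rewrite leNgt; apply/negP => lt.
  pose e := f v - (x * px w + y * py w).
  have e0 : 0 < e by rewrite subr_gt0.
  pose D := (px w - x) ^+ 2 + (py w - y) ^+ 2.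
  have D0 : 0 <= D by rewrite addr_ge0 // sqr_ge0.
  pose t := e / (D + e).
  have De : 0 < D + e by rewrite ltr_wpDl.
  have t0 : 0 < t by rewrite divr_gt0.
  have t1 : t <= 1 by rewrite ler_pdivrMr// mul1r lerDr.
  have t01 : 0 <= t <= 1 by rewrite ltW.
  have tE : t * (D + e) = e by rewrite /t mulfVK // gt_eqF.
  pose u := ((a + t * (a' - a), b + t * (b' - b)),
             (c + t * (c' - c), d + t * (d' - d))).
  have : f v <= f u.
    by apply: fmin; rewrite inE; apply/AP; split; exact: conv.
  have -> : f u = f v - 2 * t * e + t * (t * D).
    have ux : px u = x + t * (px w - x) by rewrite /x /px /=; ring.
    have uy : py u = y + t * (py w - y) by rewrite /y /py /=; ring.
    by rewrite /f ux uy /D /e /f -/x -/y; ring.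
  have h1 : t * D <= e.
    by rewrite -[leRHS]tE (mulrDr t D e) lerDl mulr_ge0 // ltW.
  have h2 : t * (t * D) <= t * e by rewrite ler_wpM2l // ltW.
  have : 0 < t * e by rewrite mulr_gt0.
  by lra.
pose s := Num.sqrt (f v).
have s0 : 0 < s by rewrite sqrtr_gt0.
have ss : s ^+ 2 = f v by rewrite sqr_sqrtr // ltW.
exists (col2 (- x / s) (- y / s)); split.
  rewrite /dot !mxE /=.
  have -> : - x / s * (- x / s) + - y / s * (- y / s) =
      (x ^+ 2 + y ^+ 2) / s ^+ 2.
    by field; rewrite gt_eqF.
  by rewrite ss -/(f v) divff // gt_eqF.
move=> P Q /rectangleP[a' [b' [la' lb' P0 P1]]].
move=> /rectangleP[c' [d' [mc' md' Q0 Q1]]].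
rewrite /dot !mxE /= P0 P1 Q0 Q1.
have : f v <= x * px ((a', b'), (c', d')) + y * py ((a', b'), (c', d')).
  by apply: key; apply/AP.
set p := px _; set q := py _ => k.
have -> : - x / s * (X 0 0 + (cos psi * a' - sin psi * b') -
    (Y 0 0 + (cos phi * c' - sin phi * d'))) +
  - y / s * (X 1 0 + (sin psi * a' + cos psi * b') -
    (Y 1 0 + (sin phi * c' + cos phi * d'))) = - ((x * p + y * q) / s).
  by rewrite /p /q /px /py /=; ring.
by rewrite oppr_lt0 divr_gt0 // (lt_le_trans fv).
Qed.

Definition rect_of (R : realType) (X : 'cV[R]_2) (psi : R) (l : 'cV[R]_2) :
    rect R :=
  Rect (X 0 0) (X 1 0) (cos psi) (sin psi) (l 0 0) (l 1 0).

Lemma inside_rect_of (R : realType) (X : 'cV[R]_2) psi l (P : 'cV[R]_2) :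
  rectangle X psi l P -> inside (rect_of X psi l) (P 0 0, P 1 0).
Proof.
move=> /rectangleP[a [b [la lb -> ->]]]; rewrite /inside /=.
have cs := cos2Dsin2 psi.
have -> : cos psi * (X 0 0 + (cos psi * a - sin psi * b) - X 0 0) +
  sin psi * (X 1 0 + (sin psi * a + cos psi * b) - X 1 0) =
  a * (cos psi ^+ 2 + sin psi ^+ 2) by ring.
have -> : cos psi * (X 1 0 + (sin psi * a + cos psi * b) - X 1 0) -
  sin psi * (X 0 0 + (cos psi * a - sin psi * b) - X 0 0) =
  b * (cos psi ^+ 2 + sin psi ^+ 2) by ring.
by rewrite cs !mulr1.
Qed.

Lemma rectangle_dist_lt0 (R : realType) (X : 'cV[R]_2) psi l (P : 'cV[R]_2) :
  rectangle_dist X psi l P < 0 -> ~ inside (rect_of X psi l) (P 0 0, P 1 0).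
Proof.
rewrite /rectangle_dist /box_dist !mxE !big_ord_recl !big_ord0 !mxE /=.
have -> : lift ord0 ord0 = 1 :> 'I_2 by apply/val_inj.
rewrite cosN sinN opprK !addr0 gt_min !subr_lt0 => /orP h [/= h1 h2].
case: h; rewrite ltNge => /negP; apply; first exact: h1.
by rewrite mulNr [- _ + _]addrC; exact: h2.
Qed.

Lemma vertex_rect_of (R : realType) (X : 'cV[R]_2) psi l e f :
  exists j, vertex (rect_of X psi l) e f =
    (corner X psi l j 0 0, corner X psi l j 1 0).
Proof.
(* The index [e + 2f] has the parity of [e] and half [f], which matches the two signs of
   [corner_sign]. *)
have [half j4] : (e + f.*2)./2 = f :> nat /\ (e + f.*2 < 4)%N.
  by case: e f => [] [].
exists (Ordinal j4); rewrite corner0E corner1E /vertex /= half.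
by rewrite exprD -mul2n exprM sqrrN expr1n expr1n mulr1.
Qed.

Lemma corner_in_rectangle (R : realType) (X : 'cV[R]_2) (psi : R)
    (l : 'cV[R]_2) j :
  0 <= l 0 0 -> 0 <= l 1 0 -> rectangle X psi l (corner X psi l j).
Proof.
move=> l0 l1; apply/rectangleP; rewrite corner0E corner1E.
exists ((-1) ^+ j * l 0 0), ((-1) ^+ j./2 * l 1 0); split.
- by rewrite normrM normrX normrN1 expr1n mul1r ger0_norm.
- by rewrite normrM normrX normrN1 expr1n mul1r ger0_norm.
- by ring.
- by ring.
Qed.

(** A common point at time [t] would give a [crossing] in the direction that separated the
    rectangles at time [s]. *)
Lemma rectangles_stay_disjoint (R : realType) (T v s t d : R)
    (X Y : R -> 'cV[R]_2) (psi phi : R -> R) (l m : 'cV[R]_2) :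
  regular_pose T X psi -> regular_pose T Y phi ->
  (forall j k, {ae @lebesgue_measure R, forall s : R, 0 <= s <= T ->
     euclidean_norm (derive1 (fun t => corner (X t) (psi t) l j) s -
                     derive1 (fun t => corner (Y t) (phi t) m k) s) <= v}) ->
  0 < d -> d <= l 0 0 -> d <= l 1 0 -> d <= m 0 0 -> d <= m 1 0 ->
  0 <= s -> s <= t -> t <= T -> v * (t - s) < d ->
  (forall k, rectangle_dist (X t) (psi t) l (corner (Y t) (phi t) m k) < 0) ->
  (forall j, rectangle_dist (Y t) (phi t) m (corner (X t) (psi t) l j) < 0) ->
  rectangle (X s) (psi s) l `&` rectangle (Y s) (phi s) m = set0 ->
  rectangle (X t) (psi t) l `&` rectangle (Y t) (phi t) m = set0.
Proof.
move=> acX acY hv d0 dl0 dl1 dm0 dm1 s0 st tT vd hO hV disj.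
have d0' := ltW d0.
have [n [n1 sep]] := rectangles_separated (le_trans d0' dl0) (le_trans d0' dl1)
  (le_trans d0' dm0) (le_trans d0' dm1) disj.
rewrite -subset0 => P [VP OP].
pose V := rect_of (X t) (psi t) l; pose O := rect_of (Y t) (phi t) m.
have U Z chi h : unit_axis (rect_of Z chi h : rect R) by exact: cos2Dsin2.
have n1' : n 0 0 ^+ 2 + n 1 0 ^+ 2 = 1 by rewrite -n1 /dot !expr2.
apply: (@no_crossing R d V O (n 0 0, n 1 0) d0 dl0 dl1 dm0 dm1 (U _ _ _)
  (U _ _ _) n1').
split.
- by exists (P 0 0, P 1 0); exact: inside_rect_of.
- move=> e f; have [j ->] := vertex_rect_of (X t) (psi t) l e f.
  exact: rectangle_dist_lt0.
- move=> e f; have [j ->] := vertex_rect_of (Y t) (phi t) m e f.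
  exact: rectangle_dist_lt0.
move=> e f e' f'.
have [j ->] := vertex_rect_of (X t) (psi t) l e f.
have [k ->] := vertex_rect_of (Y t) (phi t) m e' f'.
have := corner_displacement acX acY (hv j k) n1 s0 st tT.
have := sep _ _
  (corner_in_rectangle (X s) (psi s) j (le_trans d0' dl0) (le_trans d0' dl1))
  (corner_in_rectangle (Y s) (phi s) k (le_trans d0' dm0) (le_trans d0' dm1)).
have -> : dot n (corner (X t) (psi t) l j - corner (Y t) (phi t) m k) =
  n 0 0 * (corner (X t) (psi t) l j 0 0 - corner (Y t) (phi t) m k 0 0) +
  n 1 0 * (corner (X t) (psi t) l j 1 0 - corner (Y t) (phi t) m k 1 0).
  by rewrite /dot !mxE.
rewrite /=; set b := (X in X - _ <= _); set c := dot n _ => h1 h2.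
suff : b < d by [].
by lra.
Qed.

(** * Induction over the time steps *)

Lemma ord_max_val_lt0 (R : realType) n (F : 'I_n.+1 -> R) i :
  ord_max_val F < 0 -> F i < 0.
Proof. by apply: le_lt_trans; exact: le_bigmax. Qed.

Theorem corollary4p5 (R : realType) (T amin amax wmax : R) (k : nat)
    (l : 'cV[R]_2) (a w : R -> R) (z : R -> state R)
    (obs : 'I_k.+1 -> obstacle R) (vbar : R) (N : nat) (dt : R)
    (hT : 0 < T)
    (hl : positive_lengths l)
    (hz : point_mass_trajectory T amin amax wmax a w z)
    (hobs_len : forall i, positive_lengths (half_lengths (obs i)))
    (hobs_lip : forall i, lipschitz_obstacle T (obs i))
    (hvbar : relative_speed_bound T l z obs vbar)
    (hN : (1 <= N)%N)
    (hNT : N%:R * dt <= T)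
    (hinit : vehicle l (z 0) `&` \bigcup_i obstacle_set (obs i) 0 = set0)
    (hdt0 : 0 <= dt)
    (hdt : (dt%:E < max_time_step (min_half_length l obs) vbar)%E)
    (hg : forall n : nat, (1 <= n <= N)%N ->
       obstacle_function l obs (z (n%:R * dt)) (n%:R * dt) < 0) :
  forall n : nat, (1 <= n <= N)%N ->
    vehicle l (z (n%:R * dt))
      `&` \bigcup_i obstacle_set (obs i) (n%:R * dt) = set0.
Proof.
set d := min_half_length l obs in hdt.
have d0 : 0 < d.
  rewrite /d /min_half_length; apply: lt_bigmin => [|i _].
    by rewrite lt_min; case: hl => -> ->.
  by rewrite lt_min; case: (hobs_len i) => -> ->.
have dl : d <= Num.min (l 0 0) (l 1 0) by exact: bigmin_le_id.
have dm i : d <= Num.min (half_lengths (obs i) 0 0) (half_lengths (obs i) 1 0).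
  exact: bigmin_le.
have vdt : vbar * dt < d.
  (* For [vbar <= 0] the product is nonpositive, which includes the conventional infinite time step;
     otherwise [max_time_step] is the quotient. *)
  have [v0|v0] := leP vbar 0.
    by rewrite (le_lt_trans _ d0)// mulr_le0_ge0.
  by move: hdt; rewrite /max_time_step gt_eqF// lte_fin ltr_pdivlMr// mulrC.
(* The induction includes [n = 0], where disjointness is [hinit]: each step needs disjointness at
   the preceding time. *)
suff H n : (n <= N)%N -> vehicle l (z (n%:R * dt))
    `&` \bigcup_i obstacle_set (obs i) (n%:R * dt) = set0.
  by move=> n /andP[_ nN]; exact: H.
elim: n => [_|n IH nN]; first by rewrite mul0r.
rewrite setI_bigcupr; apply: bigcup0 => i _.
have := IH (ltnW nN); rewrite setI_bigcupr => /bigcup0P /(_ i Logic.I) disj.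
have tE : n.+1%:R * dt - n%:R * dt = dt.
  by rewrite -mulrBl -natrB// subSnn mul1r.
have gn := ord_max_val_lt0 i (hg n.+1 nN).
move: dl (dm i) gn; rewrite !le_min gt_max.
move=> /andP[dl0 dl1] /andP[dm0 dm1] /andP[g1 g2].
apply: (@rectangles_stay_disjoint R T vbar (n%:R * dt) (n.+1%:R * dt) d
  (fun t => position (z t)) (Defs.center (obs i)) (fun t => heading (z t))
  (orientation (obs i)) l (half_lengths (obs i)) _ _ _ d0 dl0 dl1 dm0 dm1).
- exact: trajectory_regular_pose hz.
- by have [h1 h2] := hobs_lip i; exact: lipschitz_regular_pose.
- by move=> j j'; exact: (hvbar j j' i).
- by rewrite mulr_ge0.
- by rewrite ler_wpM2r// ler_nat.
- by rewrite (le_trans _ hNT)// ler_wpM2r// ler_nat.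
- by rewrite tE.
- by move=> j; exact: (ord_max_val_lt0 j g1).
- by move=> j; exact: (ord_max_val_lt0 j g2).
- exact: disj.
Qed.
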